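(* Let $f,g,k_x,k_y$ satisfy the plant assumption, let $\Phi=\Phi_u+\Phi_y$ and $\mathcal U$ satisfy the cost assumption, let the plant be monotone with respect to the standard orders ($\mathcal K_U=\mathbb R^m_{\ge0}$, $\mathcal K_X=\mathbb R^n_{\ge0}$, $\mathcal K_Y=\mathbb R^p_{\ge0}$), and let $\alpha>0$ (all as described in the context). Assume that either of the following holds: (i) the plant is single-input single-output, i.e. $m=p=1$, and the function $\Phi_y$ is convex; (ii) the steady-state output map is affine, i.e. $k_y(v)=Sv+s$ for some $S\in\mathbb R^{p\times m}$, $s\in\mathbb R^p$; the cost $\Phi_u$ is twice differentiable and its Hessian $\nabla^2\Phi_u(v)$ has nonpositive off-diagonal entries for every $v\in\mathbb R^m$; and the cost $\Phi_y$ is twice differentiable and $\nabla^2\Phi_y(y)$ has all entries nonnegative for every $y\in\mathbb R^p$. Then the subsystem with input $x(\cdot)$, state $v\in\mathcal U$ and output $z=v$, $$\dot v=\Pi_{\mathcal U}\bigl(v,-\alpha\nabla\Phi_u(v)-\alpha\nabla k_y(v)^\top\nabla\Phi_y(g(x))\bigr),\qquad z=v,$$ is monotone with respect to $\mathcal K_X=\mathbb R^n_{\ge 0}$ (input), $\mathcal K_V=\mathbb R^m_{\le 0}$ (state), $\mathcal K_Z=-\mathcal K_U=\mathbb R^m_{\le 0}$ (output); that is, writing $v(t,v_0,x)$ for the solution with $v(0)=v_0\in\mathcal U$ and input $x(\cdot)$: if $x(t)\succcurlyeq_{\mathcal K_X}x'(t)$ for all $t$ and $v_0\succcurlyeq_{\mathcal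 K_V}v_0'$, then $v(t,v_0,x)\succcurlyeq_{\mathcal K_V}v(t,v_0',x')$ for all $t\ge0$; and furthermore $v\succcurlyeq_{\mathcal K_V}v'$ implies $v\succcurlyeq_{\mathcal K_Z}v'$.
   Context: **Notation.** For differentiable $h:\mathbb R^a\to\mathbb R^b$, $\nabla h(x)\in\mathbb R^{b\times a}$ is the Jacobian; for scalar $h$, $\nabla h(x)$ also denotes the gradient (column vector). For a closed convex set $S\subseteq\mathbb R^n$, $\mathrm T_S(x)=\operatorname{cl}\bigl(\bigcup_{\delta>0}\frac1\delta(S-x)\bigr)$ is the tangent cone at $x\in S$, and $\Pi_S(x,v)$ is the Euclidean projection of $v$ onto $\mathrm T_S(x)$. All solutions of differential equations are in the Carathéodory sense (absolutely continuous, satisfying the equation for almost all $t$). **Orders.** An orthant in $\mathbb R^n$ is a set $\mathcal K=\{x\in\mathbb R^n: (-1)^{\epsilon_i}x_i\ge 0\ \forall i\}$ for some $\epsilon\in\{0,1\}^n$. It induces the partial order $x\succcurlyeq_{\mathcal K}y\iff x-y\in\mathcal K$. The orthant $\mathbb R^n_{\ge0}$ gives the standard (elementwise) order. **Monotone system.** A system $\dot x=f(x,u)$, $y=g(x)$ is monotone with respect to orthants $\mathcal K_U,\mathcal K_X,\mathcal K_Y$ (in input, state and output space) if (1) for any two measurable, locally bounded inputs with $u(t)\succcurlyeq_{\mathcal K_U}u'(t)$ for almost all $t$ and any initial conditions $x_0\succcurlyeq_{\mathcal K_X}x_0'$, the corresponding solutions (assumed well defined) satisfy $x(t,x_0,u)\succcurlyeq_{\mathcal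 K_X}x(t,x_0',u')$ for all $t\ge 0$; and (2) $x\succcurlyeq_{\mathcal K_X}x'$ implies $g(x)\succcurlyeq_{\mathcal K_Y}g(x')$. **Plant assumption.** The plant is $\dot x=f(x,u)$, $y=g(x)$ with $f:\mathbb R^n\times\mathbb R^m\to\mathbb R^n$ and $g:\mathbb R^n\to\mathbb R^p$ locally Lipschitz. There is a continuous steady-state map $k_x:\mathbb R^m\to\mathbb R^n$: for every constant input $\bar u\in\mathbb R^m$ and every initial condition, the solution of the plant converges to $k_x(\bar u)$ as $t\to\infty$. The steady-state output map is $k_y:=g\circ k_x:\mathbb R^m\to\mathbb R^p$; it is continuously differentiable and $\nabla k_y:\mathbb R^m\to\mathbb R^{p\times m}$ is locally Lipschitz. **Cost assumption.** $\Phi(u,y)=\Phi_u(u)+\Phi_y(y)$ with $\Phi:\mathbb R^m\times\mathbb R^p\to\mathbb R$ continuously differentiable and $\nabla\Phi$ locally Lipschitz. The set $\mathcal U=[u_1^{\min},u_1^{\max}]\times\dots\times[u_m^{\min},u_m^{\max}]\subset\mathbb R^m$ is a compact box. *)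

(* Defs.v *)
From HB Require Import structures.
From mathcomp Require Import all_boot all_order all_algebra.
From mathcomp Require Import all_classical all_reals all_analysis.

Set Implicit Arguments.
Unset Strict Implicit.
Unset Printing Implicit Defensive.

Import Order.TTheory GRing.Theory Num.Theory.
Import numFieldNormedType.Exports.

Local Open Scope classical_set_scope.
Local Open Scope ring_scope.

(* Elements of R^n are row vectors 'rV[R]_n.  The norm `|x| of the normed
   module 'rV[R]_n is the sup norm; it is only used where the choice of a norm
   on R^n is immaterial. *)

Section calculus.
Context {R : realType}.

Definition locally_lipschitz (V W : normedModType R) (h : V -> W) : Prop :=
  forall x : V, exists2 A, nbhs x A & [lipschitz h y | y in A].

(* The library's 'J h x is the matrix M such that 'd h x v = v *m M on row
   vectors, i.e. the transpose of the b x a Jacobian matrix. *)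
Definition jac a b (h : 'rV[R]_a -> 'rV[R]_b) (x : 'rV[R]_a) : 'M[R]_(b, a) :=
  ('J h x)^T.

Definition grad a (h : 'rV[R]_a -> R) (x : 'rV[R]_a) : 'rV[R]_a :=
  \row_j ('d (h : 'rV[R]_a -> R^o) x (delta_mx 0 j) : R).

Definition hessian a (h : 'rV[R]_a -> R) (x : 'rV[R]_a) : 'M[R]_a :=
  jac (grad h) x.

Definition twice_differentiable a (h : 'rV[R]_a -> R) : Prop :=
  (forall x, differentiable (h : 'rV[R]_a -> R^o) x) /\
  (forall x, differentiable (grad h) x).

Definition absolutely_continuous_on (V : normedModType R) (a b : R)
    (x : R -> V) : Prop :=
  forall e : R, 0 < e -> exists2 d : R, 0 < d &
    forall (N : nat) (s t : 'I_N -> R),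
      (forall i, a <= s i /\ s i <= t i /\ t i <= b) ->
      trivIset setT (fun i => `]s i, t i[%classic) ->
      \sum_(i < N) (t i - s i) < d ->
      \sum_(i < N) `|x (t i) - x (s i)| < e.

End calculus.

Section projection.
Context {R : realType} {n : nat}.

Definition enorm (v : 'rV[R]_n) : R := Num.sqrt (\sum_i v 0 i ^+ 2).

Definition tangent_cone (S : set 'rV[R]_n) (x : 'rV[R]_n) : set 'rV[R]_n :=
  closure (\bigcup_(d in [set d : R | 0 < d]) [set d^-1 *: (y - x) | y in S]).

(* For S closed convex and x \in S the minimiser exists and is unique. *)
Definition tangent_proj (S : set 'rV[R]_n) (x v : 'rV[R]_n) : 'rV[R]_n :=
  get [set w | tangent_cone S x w /\
    forall w', tangent_cone S x w' -> enorm (v - w) <= enorm (v - w')].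

Definition box (lo hi : 'rV[R]_n) : set 'rV[R]_n :=
  [set v | forall i, lo 0 i <= v 0 i <= hi 0 i].

Definition orthant (eps : 'I_n -> bool) : set 'rV[R]_n :=
  [set x | forall i, 0 <= (-1) ^+ eps i * x 0 i].

Definition order_of (eps : 'I_n -> bool) (x y : 'rV[R]_n) : Prop :=
  orthant eps (x - y).

End projection.

Definition nonneg_orthant {n : nat} : 'I_n -> bool := fun=> false.
Definition nonpos_orthant {n : nat} : 'I_n -> bool := fun=> true.

Section systems.
Context {R : realType}.
Local Notation mu := (@lebesgue_measure R).

(* The measurable subsets of this type are the Lebesgue measurable sets. *)
Definition lebesgueR :=
  caratheodory_type ((@wlength R idfun)^*)%mu.

Definition admissible_input m (u : R -> 'rV[R]_m) : Prop :=
  (forall i, measurable_fun (`[0, +oo[%classic : set lebesgueR)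
     (fun t : lebesgueR => u t 0 i : measurableTypeR R)) /\
  [locally [bounded u t | t in (`[0, +oo[%classic : set R)]].

(* Caratheodory solutions on [0, +oo[ of x' = F (x, u) evolving in the state
   space X; the values of u and x at negative times are irrelevant. *)
Definition solution n m (X : set 'rV[R]_n)
    (F : 'rV[R]_n * 'rV[R]_m -> 'rV[R]_n)
    (u : R -> 'rV[R]_m) (x : R -> 'rV[R]_n) : Prop :=
  [/\ forall t : R, 0 <= t -> X (x t),
      forall T : R, 0 <= T -> absolutely_continuous_on 0 T x &
      {ae mu, forall t : R, 0 < t -> is_derive (t : R^o) 1 x (F (x t, u t))}].

Definition monotone_system n m p
    (KU : 'I_m -> bool) (KX : 'I_n -> bool) (KY : 'I_p -> bool)
    (X : set 'rV[R]_n) (F : 'rV[R]_n * 'rV[R]_m -> 'rV[R]_n)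
    (h : 'rV[R]_n -> 'rV[R]_p) : Prop :=
  (forall (u u' : R -> 'rV[R]_m) (x x' : R -> 'rV[R]_n),
     admissible_input u -> admissible_input u' ->
     {ae mu, forall t : R, 0 <= t -> order_of KU (u t) (u' t)} ->
     solution X F u x -> solution X F u' x' ->
     order_of KX (x 0) (x' 0) ->
     forall t : R, 0 <= t -> order_of KX (x t) (x' t)) /\
  (forall x x', X x -> X x' -> order_of KX x x' -> order_of KY (h x) (h x')).

End systems.

Section assumptions.
Context {R : realType}.

Record plant_assumption n m p (f : 'rV[R]_n * 'rV[R]_m -> 'rV[R]_n)
    (g : 'rV[R]_n -> 'rV[R]_p) (kx : 'rV[R]_m -> 'rV[R]_n)
    (ky : 'rV[R]_m -> 'rV[R]_p) : Prop := {
  plant_f_lip : locally_lipschitz f;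
  plant_g_lip : locally_lipschitz g;
  plant_kx_cont : continuous kx;
  plant_steady : forall (ubar : 'rV[R]_m) (x0 : 'rV[R]_n),
    (exists2 x, solution setT f (cst ubar) x & x 0 = x0) /\
    (forall x, solution setT f (cst ubar) x -> x 0 = x0 ->
       x t @[t --> +oo] --> kx ubar);
  plant_ky_def : ky = g \o kx;
  plant_ky_diff : forall v, differentiable ky v;
  plant_ky_C1 : continuous (jac ky);
  plant_ky_lip : locally_lipschitz (jac ky) }.

(* Phi : R^m x R^p -> R is viewed as a function on R^(m + p). *)
Record cost_assumption m p (Phi : 'rV[R]_(m + p) -> R)
    (Phiu : 'rV[R]_m -> R) (Phiy : 'rV[R]_p -> R)
    (umin umax : 'rV[R]_m) : Prop := {
  cost_sep : forall u y, Phi (row_mx u y) = Phiu u + Phiy y;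
  cost_diff : forall w, differentiable (Phi : 'rV[R]_(m + p) -> R^o) w;
  cost_C1 : continuous (grad Phi);
  cost_lip : locally_lipschitz (grad Phi);
  cost_box : forall i, umin 0 i <= umax 0 i }.

End assumptions.

(* Main.v *)
Require Import Defs.
From mathcomp Require Import all_boot all_order all_algebra.
From mathcomp Require Import all_classical all_reals all_analysis.
From mathcomp Require Import ring lra.

Set Implicit Arguments.
Unset Strict Implicit.
Unset Printing Implicit Defensive.

Import Order.TTheory GRing.Theory Num.Theory.
Import numFieldNormedType.Exports.

Local Open Scope classical_set_scope.
Local Open Scope ring_scope.

(** Let v and v' be two solutions with ordered inputs x >= x' and ordered
    initial values v 0 <= v' 0 (coordinatewise: for the nonpositive orthant
    the order is reversed), and let e = v - v'.  The claim is that no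
    coordinate of e ever becomes positive.  The reason is a quasimonotone
    (Kamke) condition.  Write w = - alpha (grad Phiu v + grad Phiy (g x) J v),
    J being the Jacobian of the steady-state output map, for the velocity
    before projection.  At a time where e_i > 0, the value v_i is above the
    lower face of the box and v'_i below the upper face, so projecting can
    only decrease w_i and increase w'_i ([tangent_proj_box_le],
    [tangent_proj_box_ge]), and e_i' <= w_i - w'_i.

    The difference w_i - w'_i is alpha times the difference of the gradient
    fields at (v', x') and (v, x), which splits into four steps
    ([gradient_field_gap]).
    Moving from v' to the coordinatewise maximum of v and v' costs at most
    L max_j (e_j)^+, as grad Phiu is locally Lipschitz.  Moving from this
    maximum down to v leaves coordinate i fixed, since e_i > 0, and has the
    favourable sign because the off-diagonal second derivatives of Phiu are
    nonpositive.  Replacing x' by x is favourable because grad Phiy and g are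
    monotone and J >= 0; the sign of J comes from the monotonicity of the
    plant, by comparing the limits of two solutions with constant inputs
    ([steady_output_monotone], [jac_ge0_of_monotone]).  Finally, replacing
    J v' by J v costs nothing if the steady-state output map is affine; if
    m = p = 1 the cost is again at most a constant times e^+, by the local
    Lipschitz continuity of J and a local bound on the input
    ([jacobian_gap_bound1]).

    Hence e_i' <= C max_j (e_j)^+ wherever e_i > 0, for almost all times near
    any given one at which e <= 0.  Summing, the energy
    D = sum_i ((e_i)^+)^2 is absolutely continuous, vanishes at time 0 and
    satisfies D' <= 2 m C D almost everywhere, so that it stays 0
    ([nonpos_invariant]).  That an almost everywhere bound on the derivative
    controls the increments of an absolutely continuous function
    ([absolutely_continuous_increment]) is proved without integration: the
    exceptional null set is covered by an open set of small measure, and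
    local estimates are glued along the interval by [interval_induction]. *)

(** * Coordinates of row vectors *)

Lemma ler_norm_coord (R : realType) (m : nat) (x : 'rV[R]_m) i : `|x 0 i| <= `|x|.
Proof.
rewrite [leRHS]/Num.Def.normr /= mx_normrE.
exact: (le_bigmax _ (fun ij => `|x ij.1 ij.2|) (ord0, i)).
Qed.

Lemma rV_norm_le (R : realType) (m : nat) (x : 'rV[R]_m) (B : R) :
  0 <= B -> (forall i, `|x 0 i| <= B) -> `|x| <= B.
Proof.
move=> B0 xB; rewrite [leLHS]/Num.Def.normr /= mx_normrE.
by apply: bigmax_le => // -[i j] _ /=; rewrite ord1.
Qed.

Lemma rV_coordB (R : realType) (m : nat) (x y : 'rV[R]_m) i :
  (x - y) 0 i = x 0 i - y 0 i.
Proof. by rewrite !mxE. Qed.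

Lemma is_derive_coord (R : realType) (m : nat) (e : R -> 'rV[R]_m) (t : R) i :
  derivable (e : R^o -> _) t 1 ->
  is_derive (t : R^o) 1 (fun s => e s 0 i) (('D_1 (e : R^o -> _) t) 0 i).
Proof.
move=> de; apply: DeriveDef; first by move/derivable_mxP : de; exact.
by rewrite derive_mx // mxE.
Qed.

Lemma order_of_nonneg (R : realType) (n : nat) (x y : 'rV[R]_n) :
  order_of nonneg_orthant x y <-> forall i, y 0 i <= x 0 i.
Proof.
by split=> h i; move: (h i); rewrite /nonneg_orthant /= expr0 mul1r !mxE subr_ge0.
Qed.

Lemma order_of_nonpos (R : realType) (n : nat) (x y : 'rV[R]_n) :
  order_of nonpos_orthant x y <-> forall i, x 0 i <= y 0 i.
Proof.
by split=> h i; move: (h i); rewrite /nonpos_orthant /= expr1 mulN1r !mxE oppr_ge0 subr_le0.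
Qed.

(** * Increments of absolutely continuous functions *)

(** Cousin's lemma in the form of an induction principle: the supremum of the
    points reachable from a can only be b. It is used both to glue estimates of
    increments and to pass from local to global invariance in time. *)
Lemma interval_induction (R : realType) (P : R -> R -> Prop) (a b : R) :
  a <= b ->
  (forall x y z, a <= x <= y -> y <= z <= b -> P x y -> P y z -> P x z) ->
  (forall t, a <= t <= b -> exists2 d, 0 < d &
     forall x y, a <= x <= t -> t <= y <= b ->
       t - d < x -> y < t + d -> P x y) ->
  P a b.
Proof.
move=> ab Padd Ploc.
pose S := [set y | a <= y <= b /\ P a y].
have Sa : S a.
  split; first by rewrite lexx.
  have [|d d0 Pd] := Ploc a; first by rewrite lexx.
  by apply: Pd; rewrite ?lexx ?ab //; lra.
have Sb : ubound S b by move=> y [/andP[]].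
have hS : has_sup S by split; [exists a | exists b].
have as_ : a <= sup S by apply: ub_le_sup => //; exists b.
have sb : sup S <= b by apply: ge_sup => //; exists a.
have [|d d0 Pd] := Ploc (sup S); first by rewrite as_ sb.
have [y Sy ysup] := sup_adherent d0 hS.
have ys : y <= sup S by apply: ub_le_sup => //; exists b.
case: Sy => /andP[ay yb] Pay.
have Pas : P a (sup S).
  apply: (Padd a y) => //; rewrite ?lexx ?ys ?ay //.
  by apply: Pd; rewrite ?lexx ?ys ?ay // ltrDl.
pose z := Num.min b (sup S + d / 2).
have sz : sup S <= z by rewrite /z le_min sb /=; lra.
have zb : z <= b by rewrite /z ge_min lexx.
have Paz : P a z.
  apply: (Padd a (sup S)) => //; rewrite ?lexx ?sz ?as_ //.
  apply: Pd; rewrite ?lexx ?sz ?as_ //; first lra.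
  by rewrite /z gt_min; apply/orP; right; lra.
have : z <= sup S.
  by apply: ub_le_sup; [exists b | split => //; rewrite zb andbT (le_trans as_)].
rewrite {1}/z ge_min => /orP[bs|]; last lra.
suff -> : b = sup S by [].
by apply/eqP; rewrite eq_le bs sb.
Qed.

Lemma is_derive_increment (R : realType) (h : R -> R) (t d e : R) :
  is_derive (t : R^o) 1 h d -> 0 < e ->
  exists2 r, 0 < r &
    forall u, `|u - t| < r -> `|h u - h t - d * (u - t)| <= e * `|u - t|.
Proof.
move=> [hd hD] e0.
have : ((fun k => k^-1 *: ((h \o shift t) (k *: (1 : R^o)) - h t)) @ 0^') --> d.
  by rewrite -hD; exact: hd.
move=> /cvgrPdist_le /(_ e e0) [r /= r0 hr].
exists r => // u ut.
have [->|ut0] := eqVneq u t; first by rewrite !subrr mulr0 subr0 normr0 mulr0.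
have {}ut0 : u - t != 0 by rewrite subr_eq0.
have := hr (u - t); rewrite /= sub0r normrN => /(_ ut ut0).
rewrite /= /shift /= [_ *: 1]mulr1 subrK distrC => H.
have -> : h u - h t - d * (u - t) =
  ((u - t)^-1 *: (h u - h t) - d) * (u - t).
  by rewrite mulrBl -[_ *: _]/(_ * _) mulrAC mulVf// mul1r.
by rewrite normrM ler_wpM2r.
Qed.

(** Outer regularity of the Lebesgue measure, for null sets. *)
Lemma open_cover_negligible (R : realType) (E : set R) (e : R) :
  (@lebesgue_measure R).-negligible E -> 0 < e ->
  exists U : set R, [/\ open U, E `<=` U & (lebesgue_measure U < e%:E)%E].
Proof.
move=> /negligible_outer_measure E0 e0.
have e20 : 0 < e / 2 by rewrite divr_gt0.
have [U [oU EU muU]] := outer_measure_open_le E e20.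
exists U; split=> //; apply: (le_lt_trans muU).
rewrite E0 add0e lte_fin; lra.
Qed.

(** Superadditivity in the interval, which is what makes the estimates in
    [absolutely_continuous_increment] additive. *)
Lemma lebesgue_measure_setI_itv (R : realType) (U : set R) (x y z : R) :
  open U -> x <= y <= z ->
  (lebesgue_measure (U `&` `]x, y[) + lebesgue_measure (U `&` `]y, z[) <=
   lebesgue_measure (U `&` `]x, z[))%E.
Proof.
move=> oU /andP[xy yz].
have mU : measurable U by exact: measurable_realfun.open_measurable.
have disj : (U `&` `]x, y[) `&` (U `&` `]y, z[) = set0.
  rewrite -subset0 => t [[_ /=]]; rewrite in_itv /= => /andP[_ ty].
  by move=> [_ /=]; rewrite in_itv /= => /andP[yt _]; move: (lt_trans ty yt); rewrite ltxx.
have mI u v : measurable (U `&` `]u, v[).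
  apply: measurableI; first exact: mU.
  by apply: measurable_realfun.is_interval_measurable; exact: interval_is_interval.
have mII := measurableU _ _ (mI x y) (mI y z).
have := measureU (@lebesgue_measure R) (mI x y) (mI y z) disj.
move=> <-; apply: le_measure; rewrite ?inE; [exact: mII | exact: mI |].
move=> t [[Ut /=]|[Ut /=]]; rewrite in_itv /= => /andP[t1 t2]; split=> //=;
  rewrite in_itv /=; apply/andP; split; lra.
Qed.

(** Points where the derivative exists and is at most c give increments of at
    most (c + e) times the length on small intervals around them. The other
    points lie in an open set U of small measure, where the increments over
    disjoint intervals add up to at most e by absolute continuity. The
    predicate P below records an interval on which both contributions have
    been accounted for; it is additive and holds around every point. *)
Lemma absolutely_continuous_increment (R : realType) (h : R -> R) (a b c : R) :
  a <= b -> 0 <= c -> absolutely_continuous_on a b (h : R -> R^o) ->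
  {ae @lebesgue_measure R, forall t, a < t < b ->
     exists2 d, is_derive (t : R^o) 1 h d & d <= c} ->
  h b - h a <= c * (b - a).
Proof.
move=> ab c0 hac hder.
(* Both error terms tend to 0 with e. *)
suff H e : 0 < e -> h b - h a <= (c + e) * (b - a) + e.
  apply/ler_addgt0Pl => e e0.
  have k0 : 0 < e / (b - a + 1) by apply: divr_gt0 => //; lra.
  apply: le_trans (H _ k0) _.
  rewrite mulrDl -addrA [e + _]addrC lerD2l -[X in _ * _ + X]mulr1 -mulrDr.
  by rewrite divfK//; apply/eqP; lra.
move=> e0; have [d d0 acd] := hac e e0.
have neg1 x : (@lebesgue_measure R).-negligible [set x].
  by apply/negligibleP => //; exact: lebesgue_measure_set1.
(* The end points are put into the exceptional set since the derivative is only
   known inside the interval. *)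
have negE : (@lebesgue_measure R).-negligible
   (~` [set t | a < t < b -> exists2 d, is_derive (t : R^o) 1 h d & d <= c]
    `|` ([set a] `|` [set b])).
  by do 2 apply: negligibleU => //.
have [U [oU EU muU]] := open_cover_negligible negE d0.
pose P x y := exists N (s t : 'I_N -> R),
  [/\ forall i, x <= s i /\ s i <= t i /\ t i <= y,
      trivIset setT (fun i => `]s i, t i[%classic),
      ((\sum_(i < N) (t i - s i))%:E <= lebesgue_measure (U `&` `]x, y[))%E &
      h y - h x <= (c + e) * (y - x) + \sum_(i < N) `|h (t i) - h (s i)|].
suff [N [s [t [st dst lst hst]]]] : P a b.
  apply: (le_trans hst); rewrite lerD2l ltW//; apply: acd => //.
  rewrite -lte_fin; apply: le_lt_trans muU; apply: le_trans lst _.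
  have mU := measurable_realfun.open_measurable oU.
  have mI : measurable (U `&` `]a, b[).
    apply: measurableI; first exact: mU.
    by apply: measurable_realfun.is_interval_measurable; exact: interval_is_interval.
  by apply: le_measure; rewrite ?inE; [exact: mI | exact: mU | exact: subIsetl].
(* Adjacent families of intervals are concatenated, the second one after the
   first, through the bijection between 'I_(N1 + N2) and 'I_N1 + 'I_N2. *)
apply: interval_induction => //.
- move=> x y z /andP[ax xy] /andP[yz zb].
  move=> [N1 [s1 [t1 [st1 dst1 lst1 hst1]]]] [N2 [s2 [t2 [st2 dst2 lst2 hst2]]]].
  exists (N1 + N2)%N.
  exists (fun i => match fintype.split i with inl j => s1 j | inr j => s2 j end).
  exists (fun i => match fintype.split i with inl j => t1 j | inr j => t2 j end).
  have sE (f1 : 'I_N1 -> R) (f2 : 'I_N2 -> R) : \sum_(i < N1 + N2)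
     (match fintype.split i with inl j => f1 j | inr j => f2 j end) =
     \sum_(i < N1) f1 i + \sum_(i < N2) f2 i.
    rewrite big_split_ord; congr (_ + _); apply: eq_bigr => i _.
      by have -> : fintype.split (lshift N2 i) = inl i by exact: (unsplitK (inl i)).
    by have -> : fintype.split (rshift N1 i) = inr i by exact: (unsplitK (inr i)).
  split.
  + move=> i; case: (fintype.split i) => j.
      by have [? [? ?]] := st1 j; do !split; lra.
    by have [? [? ?]] := st2 j; do !split; lra.
  + apply/trivIsetP => i j _ _ ij.
    have {ij} : fintype.split i != fintype.split j.
      by apply: contra ij => /eqP ij; rewrite -(splitK i) -(splitK j) ij.
    case: (fintype.split i) => i'; case: (fintype.split j) => j' ij.
    * by move/trivIsetP : dst1; apply=> //; apply: contra ij => /eqP ->.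
    * rewrite -subset0 => r [/=]; rewrite !in_itv /=.
      have [_ [_ ?]] := st1 i'; have [? [_ _]] := st2 j'; lra.
    * rewrite -subset0 => r [/=]; rewrite !in_itv /=.
      have [_ [_ ?]] := st1 j'; have [? [_ _]] := st2 i'; lra.
    * by move/trivIsetP : dst2; apply=> //; apply: contra ij => /eqP ->.
  + rewrite (eq_bigr (fun i => match fintype.split i with
      inl j => t1 j - s1 j | inr j => t2 j - s2 j end)); last first.
      by move=> i _; case: fintype.split.
    rewrite sE EFinD; apply: le_trans (lebesgue_measure_setI_itv oU (y := y) _).
      exact: leeD.
    by rewrite xy yz.
  + rewrite (eq_bigr (fun i => match fintype.split i with
      inl j => `|h (t1 j) - h (s1 j)| | inr j => `|h (t2 j) - h (s2 j)| end)).
      rewrite sE; move: hst1 hst2.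
      move: (\sum_(i < N1) _) (\sum_(i < N2) _) => A1 A2 ? ?; nra.
    by move=> i _; case: fintype.split.
- move=> t /andP[at_ tb].
  have ce0 : 0 <= c + e by rewrite addr_ge0 // ltW.
  have [Ut|Ut] := pselect (U t).
    (* Around a point of U the whole interval is charged to U. *)
    have [r r0 tU] : exists2 r, 0 < r & ball t r `<=` U.
      by move/nbhs_ballP : (open_nbhs_nbhs (conj oU Ut)) => [r r0 ?]; exists r.
    exists r => // x y /andP[ax xt] /andP[ty yb] tx yt.
    exists 1%N, (fun=> x), (fun=> y); split.
    + by move=> _; rewrite !lexx (le_trans xt ty).
    + by apply/trivIsetP => i j; rewrite !ord1 eqxx.
    + rewrite big_ord1 (_ : _ `&` _ = `]x, y[%classic).
        rewrite lebesgue_measure_itv /= lte_fin; case: ltP => //.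
        by rewrite lee_fin subr_le0.
      apply: setIidr => u /=; rewrite in_itv /= => /andP[xu uy].
      by apply: tU; rewrite /ball /= ltr_distlC; apply/andP; split; lra.
    + rewrite big_ord1; apply: (le_trans (ler_norm _)).
      by rewrite lerDr mulr_ge0 //; lra.
  (* Outside U the derivative exists and no interval is charged to U. *)
  have [dt ta tb'] : [/\ a < t < b -> exists2 d, is_derive (t : R^o) 1 h d & d <= c,
      t != a & t != b].
    split.
    + by apply: contrapT => nd; apply: Ut; apply: EU; left.
    + by apply/eqP => ta; apply: Ut; apply: EU; right; left.
    + by apply/eqP => tb'; apply: Ut; apply: EU; right; right.
  have {}dt := dt _; rewrite !lt_neqAle eq_sym ta at_ tb' tb /= in dt.
  have {dt} [l hl lc] := dt isT.
  have [r r0 hr] := is_derive_increment hl e0.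
  exists r => // x y /andP[ax xt] /andP[ty yb] tx yt.
  exists 0%N, (fun=> 0), (fun=> 0); split.
  + by case.
  + by apply/trivIsetP => -[].
  + by rewrite big_ord0 measure_ge0.
  + rewrite big_ord0 addr0.
    have yt' : `|y - t| < r by rewrite ger0_norm; lra.
    have xt' : `|x - t| < r by rewrite ler0_norm; lra.
    have /ler_normlP[_] := hr y yt'; rewrite ger0_norm ?subr_ge0 // => hy.
    have /ler_normlP[+ _] := hr x xt'; rewrite ler0_norm ?subr_le0 // => hx.
    have : l * (y - x) <= c * (y - x) by rewrite ler_wpM2r //; lra.
    nra.
Qed.

Lemma absolutely_continuous_dist (R : realType) (V : normedModType R) (e : R -> V)
    (a b eps : R) :
  absolutely_continuous_on a b e -> 0 < eps ->
  exists2 d, 0 < d & forall s t, a <= s <= b -> a <= t <= b -> `|t - s| < d ->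
    `|e t - e s| < eps.
Proof.
move=> ac eps0; have [d d0 acd] := ac _ eps0; exists d => // s t.
wlog st : s t / s <= t.
  move=> H sab tab; have [st|/ltW ts] := leP s t; first exact: H.
  by rewrite distrC [`|e t - _|]distrC; exact: H.
move=> /andP[as_ sb] /andP[at_ tb]; rewrite ger0_norm ?subr_ge0 // => std.
have := acd 1%N (fun=> s) (fun=> t); rewrite !big_ord1; apply=> //.
by apply/trivIsetP => i j; rewrite !ord1 eqxx.
Qed.

Lemma ae_lebesgue_imply2 (R : realType) (P Q S : R -> Prop) :
  {ae @lebesgue_measure R, forall t, P t} ->
  {ae @lebesgue_measure R, forall t, Q t} ->
  (forall t, P t -> Q t -> S t) ->
  {ae @lebesgue_measure R, forall t, S t}.
Proof.
move=> hP hQ PQS; apply: negligibleS (negligibleU hP hQ).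
move=> t; apply: contra_notP => /not_orP[/contrapT Pt /contrapT Qt].
exact: PQS.
Qed.

Lemma absolutely_continuous_near (R : realType) (V : normedModType R) (x : R -> V)
    (s eps : R) :
  (forall T, 0 <= T -> absolutely_continuous_on 0 T x) -> 0 <= s -> 0 < eps ->
  exists2 r, 0 < r & forall t, 0 <= t -> `|t - s| < r -> `|x t - x s| < eps.
Proof.
move=> ac s0 eps0; have s1 : 0 <= s + 1 by rewrite addr_ge0.
have [d d0 hd] := absolutely_continuous_dist (ac _ s1) eps0.
exists (Num.min d 1); first by rewrite lt_min d0 ltr01.
move=> t t0; rewrite lt_min => /andP[td t1]; apply: hd => //.
  by rewrite s0 lerDl ler01.
by rewrite t0 -lerBlDl; apply: le_trans (ltW t1); exact: ler_norm.
Qed.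

(** * The energy of the positive part *)

(** The square makes the positive part differentiable everywhere. *)
Definition pospart_sq (R : realType) (r : R) : R := Num.max r 0 ^+ 2.

Lemma pospart_sq_ge0 (R : realType) (r : R) : 0 <= pospart_sq r.
Proof. exact: sqr_ge0. Qed.

(** Quadratic remainder of the first-order expansion; it covers the kink at 0
    together with all other points. *)
Lemma pospart_sq_increment (R : realType) (r k : R) :
  `|pospart_sq (r + k) - pospart_sq r - 2 * Num.max r 0 * k| <= k ^+ 2.
Proof.
rewrite /pospart_sq ler_norml.
by case: (leP r 0) => ?; case: (leP (r + k) 0) => ?; apply/andP; split; nra.
Qed.

Lemma is_derive_pospart_sq (R : realType) (r : R) :
  is_derive r 1 (@pospart_sq R) (2 * Num.max r 0).
Proof.
suff H : (fun k => k^-1 *: ((@pospart_sq R \o shift r) (k *: 1) - pospart_sq r))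
    @ 0^' --> 2 * Num.max r 0.
  by apply: DeriveDef; [apply/cvg_ex; eexists; exact: H | exact: cvg_lim H].
apply/cvgrPdist_le => /= e e0; exists e => // k /=.
rewrite sub0r normrN => ke k0; apply: le_trans (ltW ke).
rewrite [k *: 1]mulr1 [k + r]addrC distrC.
have -> : k^-1 *: (pospart_sq (r + k) - pospart_sq r) - 2 * Num.max r 0 =
  k^-1 * (pospart_sq (r + k) - pospart_sq r - 2 * Num.max r 0 * k).
  by rewrite -[_ *: _]/(_ * _) [RHS]mulrBr; congr (_ - _); rewrite [RHS]mulrC mulfK.
rewrite normrM normfV ler_pdivrMl ?normr_gt0 // -expr2 -normrX.
by apply: le_trans (pospart_sq_increment r k) _; rewrite ger0_norm // sqr_ge0.
Qed.

Lemma pospart_sq_lipschitz (R : realType) (B u v : R) :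
  `|u| <= B -> `|v| <= B -> `|pospart_sq u - pospart_sq v| <= 2 * B * `|u - v|.
Proof.
move=> uB vB; rewrite /pospart_sq subr_sqr normrM mulrC.
apply: ler_pM => //.
  rewrite ger0_norm ?addr_ge0 ?le_max ?lexx ?orbT //.
  have h w : `|w| <= B -> Num.max w 0 <= B.
    by move=> wB; rewrite ge_max (le_trans (ler_norm _) wB) (le_trans _ wB).
  by have := h _ uB; have := h _ vB; lra.
case: (leP u 0) => u0; case: (leP v 0) => v0; rewrite ?subrr ?normr0 //.
- by rewrite sub0r normrN (gtr0_norm v0) ler0_norm; lra.
- by rewrite subr0 (gtr0_norm u0) ger0_norm; lra.
Qed.

(** The quantity D of the introductory comment, a Lyapunov function for the
    nonpositive orthant. *)
Definition pospart_energy (R : realType) (m : nat) (x : 'rV[R]_m) : R :=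
  \sum_i pospart_sq (x 0 i).

Lemma pospart_energy_le0 (R : realType) (m : nat) (x : 'rV[R]_m) :
  pospart_energy x <= 0 <-> forall i, x 0 i <= 0.
Proof.
split=> [x0 i|x0].
  rewrite leNgt; apply/negP => xi; move: x0; rewrite leNgt => /negP; apply.
  rewrite /pospart_energy (bigD1 i) //= ltr_wpDr //.
    by apply: sumr_ge0 => j _; exact: pospart_sq_ge0.
  by rewrite /pospart_sq max_l ?ltW // exprn_gt0.
rewrite /pospart_energy big1 // => i _.
by rewrite /pospart_sq max_r // expr0n.
Qed.

Lemma pospart_sq_le_energy (R : realType) (m : nat) (x : 'rV[R]_m) i :
  pospart_sq (x 0 i) <= pospart_energy x.
Proof.
rewrite /pospart_energy (bigD1 i) //= lerDl.
by apply: sumr_ge0 => j _; exact: pospart_sq_ge0.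
Qed.

Lemma is_derive_pospart_energy (R : realType) (m : nat) (e : R -> 'rV[R]_m) (t : R) :
  derivable (e : R^o -> _) t 1 ->
  is_derive (t : R^o) 1 (fun s => pospart_energy (e s))
    (\sum_i 2 * Num.max (e t 0 i) 0 * ('D_1 (e : R^o -> _) t) 0 i).
Proof.
move=> de.
have -> : (fun s => pospart_energy (e s)) =
    \sum_i (@pospart_sq R \o (fun s => e s 0 i)).
  by apply/funext => s; rewrite fct_sumE.
apply: is_derive_sum => i; apply: is_derive1_comp.
  exact: is_derive_pospart_sq.
exact: is_derive_coord.
Qed.

(** On a bounded set the energy is Lipschitz, and Lipschitz functions preserve
    absolute continuity. *)
Lemma absolutely_continuous_pospart_energy (R : realType) (m : nat)
    (e : R -> 'rV[R]_m) (a b x y B : R) :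
  a <= x -> y <= b -> absolutely_continuous_on a b e ->
  (forall t, x <= t <= y -> `|e t| <= B) ->
  absolutely_continuous_on x y ((fun s => pospart_energy (e s)) : R -> R^o).
Proof.
move=> ax yb ac eB eps eps0.
pose L := m%:R * (2 * `|B|) + 1.
have L0 : 0 < L by rewrite ltr_wpDl // !mulr_ge0.
have [d d0 acd] := ac (eps / L) (divr_gt0 eps0 L0).
exists d => // N s t st dst lst.
have {}acd := acd N s t _ dst lst.
have lip (u v : 'rV[R]_m) : `|u| <= B -> `|v| <= B ->
    `|pospart_energy u - pospart_energy v| <= L * `|u - v|.
  move=> uB vB; rewrite /pospart_energy -sumrB.
  apply: (le_trans (ler_norm_sum _ _ _)).
  apply: (@le_trans _ _ (\sum_(i < m) 2 * `|B| * `|u - v|)).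
    apply: ler_sum => i _.
    have := @pospart_sq_lipschitz R `|B| (u 0 i) (v 0 i).
    have BB := ler_norm B.
    rewrite !(le_trans (ler_norm_coord _ _)) ?(le_trans uB) ?(le_trans vB) //.
    move=> /(_ isT isT) /le_trans; apply; apply: ler_wpM2l; first by rewrite mulr_ge0.
    by have := ler_norm_coord (u - v) i; rewrite !mxE.
  rewrite sumr_const card_ord -[leLHS]mulr_natl mulrA ler_wpM2r // /L; lra.
apply: (@le_lt_trans _ _ (\sum_(i < N) L * `|e (t i) - e (s i)|)).
  apply: ler_sum => i _; apply: lip; apply: eB; have [? [? ?]] := st i; lra.
rewrite -mulr_sumr mulrC -ltr_pdivlMr //; apply: acd => i.
have [? [? ?]] := st i; do !split; lra.
Qed.

(** * One-sided differential inequalities *)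

(** The supremum Q of f satisfies Q <= Q / 2 unless it is already nonpositive.
    Applied to the energy, this replaces Gronwall's inequality. *)
Lemma halving_bound (R : realType) (f : R -> R) (x y B : R) : x <= y ->
  (forall t, x <= t <= y -> f t <= B) ->
  (forall Q, 0 <= Q -> (forall t, x <= t <= y -> f t <= Q) ->
     forall t, x <= t <= y -> f t <= Q / 2) ->
  f y <= 0.
Proof.
move=> xy fB fQ.
pose S := [set f t | t in [set t | x <= t <= y]].
have S0 : S !=set0 by exists (f x), x => //=; rewrite lexx.
have hS : has_sup S by split => //; exists B => _ [t /= tt <-]; exact: fB.
have fS t : x <= t <= y -> f t <= sup S.
  by move=> tt; apply: ub_le_sup; [exact: hS.2 | exists t].
have fy : f y <= sup S by apply: fS; rewrite lexx xy.
have [S0'|S0'] := leP (sup S) 0; first exact: le_trans S0'.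
have : sup S <= sup S / 2.
  by apply: ge_sup => // _ [t /= tt <-]; apply: (fQ _ (ltW S0')).
lra.
Qed.

(** The hypothesis on the derivatives is only needed near the times at which
    e <= 0, with constants depending on that time: intervals around any other
    time need no argument since their left end points violate e <= 0 as well.
    The bound max_j (e_j)^+ is expressed by quantifying over all upper bounds M
    of the coordinates. *)
Lemma nonpos_invariant (R : realType) (m : nat) (e : R -> 'rV[R]_m) :
  (forall T, 0 <= T -> absolutely_continuous_on 0 T e) ->
  {ae @lebesgue_measure R, forall t, 0 < t -> derivable (e : R^o -> _) t 1} ->
  (forall s, 0 <= s -> (forall i, e s 0 i <= 0) ->
     exists C r, [/\ 0 <= C, 0 < r &
       {ae @lebesgue_measure R, forall t, 0 < t -> `|t - s| < r ->
          forall M i, (forall j, e t 0 j <= M) -> 0 < e t 0 i ->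
            ('D_1 (e : R^o -> _) t) 0 i <= C * M}]) ->
  (forall i, e 0 0 i <= 0) ->
  forall t, 0 <= t -> forall i, e t 0 i <= 0.
Proof.
move=> ac de rate e0 T T0.
(* This property of intervals is additive, so it only has to hold locally. *)
pose P x y := (forall i, e x 0 i <= 0) -> (forall i, e y 0 i <= 0).
suff : P 0 T by exact.
apply: interval_induction => //.
  by move=> x y z _ _ Pxy Pyz /Pxy /Pyz.
move=> s /andP[s0 sT].
(* If e_i s > 0 then e_i > 0 just before s, so the premise of P fails. *)
have [es|/existsNP[i /negP]] := pselect (forall i, e s 0 i <= 0); last first.
  rewrite -ltNge => ei.
  have [d d0 ed] := absolutely_continuous_dist (ac T T0) ei.
  exists d => // x y /andP[x0 xs] _ sx _ /(_ i) ex.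
  have := ed x s; rewrite x0 s0 sT (le_trans xs sT) => /(_ isT isT).
  rewrite ger0_norm ?subr_ge0 // ltrBlDr -ltrBlDl => /(_ ltac:(lra)).
  move=> /(le_lt_trans (ler_norm_coord _ i)); rewrite !mxE ltr_norml; lra.
have [C [r [C0 r0 eC]]] := rate s s0 es.
have [d d0 ed] := absolutely_continuous_dist (ac T T0) (ltr01 : 0 < (1 : R)).
(* L bounds half of the rate 2 m C in D' <= 2 m C D; an interval of length
   2 rho <= (4 L)^-1 is short enough for a bound Q of D to improve to Q / 2. *)
pose L := m%:R * C + 1.
have L0 : 0 < L by rewrite ltr_wpDl // mulr_ge0.
pose rho := Num.min (Num.min r d) (8 * L)^-1.
have rho0 : 0 < rho by rewrite /rho !lt_min r0 d0 invr_gt0 mulr_gt0.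
exists rho => // x y /andP[x0 xs] /andP[sy yT] sx ys ex.
have nears t : x <= t <= y -> `|t - s| < rho.
  by move=> /andP[xt ty]; rewrite ltr_distl; apply/andP; split; lra.
pose B := `|e s| + 1.
have eB t : x <= t <= y -> `|e t| <= B.
  move=> tt; have := nears t tt; rewrite /rho !lt_min => /andP[/andP[_ td] _].
  have /andP[xt ty] := tt.
  have := ed s t; rewrite s0 sT (le_trans x0 xt) (le_trans ty yT) td.
  move=> /(_ isT isT isT) ets; rewrite /B -[e t](subrK (e s)) addrC.
  by apply: (le_trans (ler_normD _ _)); rewrite lerD2l ltW.
apply/pospart_energy_le0.
apply: (@halving_bound _ (fun t => pospart_energy (e t)) x y (m%:R * B ^+ 2)).
- exact: le_trans sy.
- move=> t tt; rewrite /pospart_energy -[m in m%:R]card_ord mulr_natl -sumr_const.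
  apply: ler_sum => i _; rewrite /pospart_sq lerXn2r ?nnegrE ?le_max ?lexx ?orbT //.
    by rewrite /B addr_ge0.
  rewrite ge_max; apply/andP; split; last by rewrite addr_ge0.
  by apply: le_trans (eB t tt); apply: le_trans (ler_norm_coord _ i); exact: ler_norm.
move=> Q Q0 eQ t /andP[xt ty].
have Ex : pospart_energy (e x) <= 0 by apply/pospart_energy_le0.
have c0 : 0 <= 2 * (m%:R * C) * Q by rewrite !mulr_ge0.
have := @absolutely_continuous_increment R (fun t => pospart_energy (e t)) x t _ xt c0.
have acE : absolutely_continuous_on x t ((fun s => pospart_energy (e s)) : R -> R^o).
  apply: (@absolutely_continuous_pospart_energy _ _ _ 0 T _ _ B) => //.
  - exact: le_trans yT.
  - exact: ac.
  - by move=> u /andP[xu ut]; apply: eB; rewrite xu (le_trans ut ty).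
move=> /(_ acE) H.
have {H} : pospart_energy (e t) - pospart_energy (e x) <= 2 * (m%:R * C) * Q * (t - x).
  apply: H; apply: (ae_lebesgue_imply2 de eC) => u du uC /andP[xu ut].
  have u0 : 0 < u by exact: le_lt_trans xu.
  have uxy : x <= u <= y by rewrite ltW //= (le_trans (ltW ut)).
  eexists; first exact: is_derive_pospart_energy (du u0).
  (* If D <= Q then all (e_j)^+ are at most M = sqrt Q, so that
     (e_i)^+ e_i' <= sqrt Q * (C * sqrt Q) = C Q. *)
  have sQ j : Num.max (e u 0 j) 0 <= Num.sqrt Q.
    rewrite -[leLHS](@ger0_norm) ?le_max ?lexx ?orbT // -sqrtr_sqr ler_sqrt //.
    exact: le_trans (pospart_sq_le_energy _ _) (eQ _ uxy).
  have -> : 2 * (m%:R * C) * Q = \sum_(i < m) 2 * C * Q.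
    by rewrite sumr_const card_ord -mulr_natl; ring.
  apply: ler_sum => i _; rewrite -!mulrA ler_pM2l //.
  have [ei|ei] := leP (e u 0 i) 0; first by rewrite mul0r mulr_ge0.
  have ur : `|u - s| < r.
    by have := nears u uxy; rewrite /rho !lt_min => /andP[/andP[]].
  have Di := uC u0 ur (Num.sqrt Q) i _ ei.
  have {}Di := Di (fun j => le_trans _ (sQ j)).
  rewrite -[Q in leRHS]sqr_sqrtr // expr2 mulrCA.
  have := sQ i; rewrite max_l ?(ltW ei) // => eiQ.
  apply: (@le_trans _ _ (e u 0 i * (C * Num.sqrt Q))).
    by rewrite ler_pM2l //; apply: Di => j; rewrite le_max lexx.
  by apply: ler_wpM2r => //; rewrite mulr_ge0 // sqrtr_ge0.
suff : 2 * (m%:R * C) * Q * (t - x) <= Q / 2 by lra.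
have tx : 8 * L * (t - x) <= 2.
  have h1 := nears t; have : t - x < 2 * (8 * L)^-1.
    have : rho <= (8 * L)^-1 by rewrite /rho ge_min lexx orbT.
    lra.
  by rewrite ltr_pdivlMr ?mulr_gt0 // => /ltW; rewrite [_ * L * _]mulrC.
have : m%:R * C <= L by rewrite /L; lra.
have mC0 : 0 <= m%:R * C by rewrite mulr_ge0.
have tx0 : 0 <= t - x by lra.
move=> mCL; have : (m%:R * C) * (t - x) <= L * (t - x) by rewrite ler_wpM2r.
move=> h; have h2 : 4 * ((m%:R * C) * (t - x)) <= 1 by lra.
have -> : 2 * (m%:R * C) * Q * (t - x) = Q / 2 * (4 * ((m%:R * C) * (t - x))) by field.
by rewrite ler_piMr // divr_ge0.
Qed.

(** * Projected flows on a box *)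

Section BoxProjection.
Variables (R : realType) (n : nat) (lo hi v : 'rV[R]_n).
Hypothesis v_box : box lo hi v.

(** The tangent cone of the box at v, see [tangent_cone_boxP]: no component may
    point out of an active face. *)
Definition inward (w : 'rV[R]_n) :=
  forall i, (v 0 i = lo 0 i -> 0 <= w 0 i) /\ (v 0 i = hi 0 i -> w 0 i <= 0).

(** The sign b treats lower and upper faces alike. *)
Lemma nbhs_coord_sign_lt (w : 'rV[R]_n) i (b : bool) :
  w 0 i * (-1) ^+ b < 0 -> nbhs w [set u : 'rV[R]_n | u 0 i * (-1) ^+ b < 0].
Proof.
move=> wi.
have c : {for w, continuous (fun u : 'rV[R]_n => u 0 i * (-1) ^+ b)}.
  by apply: continuousM; [exact: coord_continuous | exact: cst_continuous].
exact: (cvgr_lt _ c _ wi).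
Qed.

(** The cone is closed, so the closure in its definition adds nothing; conversely an
    inward vector is feasible with a small enough positive step, uniformly over the
    finitely many coordinates. *)
Lemma tangent_cone_boxP (w : 'rV[R]_n) : tangent_cone (box lo hi) v w <-> inward w.
Proof.
split=> [wT i|win].
  have loc (b : bool) : (forall y, box lo hi y -> 0 <= (y 0 i - v 0 i) * (-1) ^+ b) ->
      0 <= w 0 i * (-1) ^+ b.
    move=> hb; rewrite leNgt; apply/negP => wb.
    have nw : nbhs w [set u : 'rV[R]_n | u 0 i * (-1) ^+ b < 0].
      exact: nbhs_coord_sign_lt.
    have [_ [[d /= d0 [y ybox <-]]]] := wT _ nw.
    by rewrite /= !mxE -mulrA pmulr_rlt0 ?invr_gt0 // ltNge hb.
  split=> vi.
    have := loc false; rewrite expr0 mulr1; apply=> y /(_ i) /andP[? _].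
    by rewrite mulr1 vi subr_ge0.
  have := loc true; rewrite expr1 mulrN1 oppr_ge0; apply=> y /(_ i) /andP[_ ?].
  by rewrite mulrN1 oppr_ge0 vi subr_le0.
suff [d d0 dbox] : exists2 d : R, 0 < d & box lo hi (v + d *: w).
  apply: subset_closure; exists d => //; exists (v + d *: w) => //.
  by rewrite addrC addKr scalerA mulVf ?scale1r // gt_eqF.
have feas i : \forall d \near (0 : R)^'+,
    lo 0 i <= (v + d *: w) 0 i <= hi 0 i.
  have /andP[vlo vhi] := v_box i; have [wlo whi] := win i.
  have [wi|wi|wi] := ltgtP (w 0 i) 0.
  - have vl : 0 < v 0 i - lo 0 i.
      rewrite subr_gt0 lt_neqAle vlo andbT; apply/eqP => e.
      by move: (wlo (esym e)); rewrite leNgt wi.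
    have q0 : 0 < (v 0 i - lo 0 i) / (- w 0 i) by rewrite divr_gt0 // oppr_gt0.
    near=> d.
    have d0 : 0 < d by near: d; exact: nbhs_right_gt.
    have : d <= (v 0 i - lo 0 i) / (- w 0 i) by near: d; exact: nbhs_right_le.
    by rewrite ler_pdivlMr ?oppr_gt0 // !mxE => ?; apply/andP; split; nra.
  - have vl : 0 < hi 0 i - v 0 i.
      rewrite subr_gt0 lt_neqAle vhi andbT; apply/eqP => e.
      by move: (whi e); rewrite leNgt wi.
    have q0 : 0 < (hi 0 i - v 0 i) / w 0 i by rewrite divr_gt0.
    near=> d.
    have d0 : 0 < d by near: d; exact: nbhs_right_gt.
    have : d <= (hi 0 i - v 0 i) / w 0 i by near: d; exact: nbhs_right_le.
    by rewrite ler_pdivlMr // !mxE => ?; apply/andP; split; nra.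
  - by near=> d; rewrite !mxE wi mulr0 addr0 vlo vhi.
near (0 : R)^'+ => d; exists d; first by near: d; exact: nbhs_right_gt.
by near: d; exact: filter_forall.
Unshelve. all: by end_near. Qed.

(** Clipping w coordinatewise gives a minimiser, so the choice made in
    [tangent_proj] is a minimiser as well. *)
Lemma tangent_proj_box_spec (w : 'rV[R]_n) :
  inward (tangent_proj (box lo hi) v w) /\
  forall w', inward w' -> enorm (w - tangent_proj (box lo hi) v w) <= enorm (w - w').
Proof.
(* Both faces are active where lo and hi coincide, and there only 0 is admissible. *)
pose c := \row_i (if v 0 i == lo 0 i then
                    if v 0 i == hi 0 i then 0 else Num.max (w 0 i) 0
                  else if v 0 i == hi 0 i then Num.min (w 0 i) 0 else w 0 i).
have cin : inward c.
  move=> i; rewrite mxE; split=> ->; rewrite eqxx; case: eqP => // _.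
    by rewrite le_max lexx orbT.
  by rewrite ge_min lexx orbT.
pose best := [set u | tangent_cone (box lo hi) v u /\
  forall u', tangent_cone (box lo hi) v u' -> enorm (w - u) <= enorm (w - u')].
suff bc : best c.
  have [/tangent_cone_boxP pin pmin] : best (tangent_proj (box lo hi) v w) := getI bc.
  by split=> // w' /tangent_cone_boxP; exact: pmin.
split; first exact/tangent_cone_boxP.
move=> w' /tangent_cone_boxP w'in; apply: ler_wsqrtr; apply: ler_sum => i _.
have [wlo whi] := w'in i; rewrite !mxE -[leLHS]real_normK ?num_real //.
rewrite -[leRHS]real_normK ?num_real // lerXn2r ?nnegrE //.
case: eqP => [/wlo {}wlo|_]; case: eqP => [/whi {}whi|_].
- by have -> : w' 0 i = 0 by lra.
- case: (leP (w 0 i) 0) => ?; last by rewrite subrr normr0.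
  by rewrite !ler0_norm; lra.
- case: (leP (w 0 i) 0) => ?; first by rewrite subrr normr0.
  by rewrite !ger0_norm; lra.
- by rewrite subrr normr0.
Qed.

(** Otherwise resetting the i-th coordinate of the projection to w i would give a
    strictly closer inward vector. *)
Lemma tangent_proj_box_eq (w : 'rV[R]_n) i :
  let P := tangent_proj (box lo hi) v w in
  (v 0 i = lo 0 i -> 0 <= w 0 i) -> (v 0 i = hi 0 i -> w 0 i <= 0) ->
  P 0 i = w 0 i.
Proof.
move=> P wlo whi; have [Pin Pmin] := tangent_proj_box_spec w.
pose Q := \row_j (if j == i then w 0 j else P 0 j).
have Qin : inward Q.
  by move=> j; rewrite mxE; case: eqP => [->|_]; [split | exact: Pin].
have := Pmin _ Qin.
rewrite /enorm ler_sqrt; last by apply: sumr_ge0 => j _; exact: sqr_ge0.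
rewrite (bigD1 i) //= [leRHS](bigD1 i) //=.
rewrite [X in _ <= _ + X](eq_bigr (fun j => (w - P) 0 j ^+ 2)); last first.
  by move=> j /negPf ji; rewrite !mxE ji.
rewrite lerD2r !mxE eqxx subrr expr0n /= => h; apply/eqP.
by rewrite eq_sym -subr_eq0 -sqrf_eq0 eq_le h sqr_ge0.
Qed.

(** Only an active lower face can push a coordinate of w up. *)
Lemma tangent_proj_box_le (w : 'rV[R]_n) i :
  lo 0 i < v 0 i -> tangent_proj (box lo hi) v w 0 i <= w 0 i.
Proof.
move=> vlo; have [w0|/ltW w0] := leP (w 0 i) 0.
  by rewrite tangent_proj_box_eq // => e; move: vlo; rewrite e ltxx.
have [vhi|/eqP vhi] := eqVneq (v 0 i) (hi 0 i).
  by have [/(_ i)[_ /(_ vhi) h] _] := tangent_proj_box_spec w; exact: le_trans w0.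
by rewrite tangent_proj_box_eq.
Qed.

Lemma tangent_proj_box_ge (w : 'rV[R]_n) i :
  v 0 i < hi 0 i -> w 0 i <= tangent_proj (box lo hi) v w 0 i.
Proof.
move=> vhi; have [w0|/ltW w0] := leP 0 (w 0 i).
  by rewrite tangent_proj_box_eq // => e; move: vhi; rewrite e ltxx.
have [vlo|/eqP vlo] := eqVneq (v 0 i) (lo 0 i).
  by have [/(_ i)[/(_ vlo) h _] _] := tangent_proj_box_spec w; exact: le_trans w0 h.
by rewrite tangent_proj_box_eq.
Qed.

End BoxProjection.

(** Where v_i > v'_i neither the lower face is active for v_i nor the upper face
    for v'_i, so the projections only help, and quasimonotonicity of the
    unprojected velocities w, w' is enough. *)
Lemma projected_flow_comparison (R : realType) (m : nat) (lo hi : 'rV[R]_m)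
    (w w' v v' : R -> 'rV[R]_m) :
  (forall t, 0 <= t -> box lo hi (v t)) -> (forall t, 0 <= t -> box lo hi (v' t)) ->
  (forall T, 0 <= T -> absolutely_continuous_on 0 T v) ->
  (forall T, 0 <= T -> absolutely_continuous_on 0 T v') ->
  {ae @lebesgue_measure R, forall t, 0 < t ->
     is_derive (t : R^o) 1 v (tangent_proj (box lo hi) (v t) (w t))} ->
  {ae @lebesgue_measure R, forall t, 0 < t ->
     is_derive (t : R^o) 1 v' (tangent_proj (box lo hi) (v' t) (w' t))} ->
  (forall s, 0 <= s -> (forall i, v s 0 i <= v' s 0 i) ->
     exists C r, [/\ 0 <= C, 0 < r &
       {ae @lebesgue_measure R, forall t, 0 < t -> `|t - s| < r ->
          forall M i, (forall j, v t 0 j - v' t 0 j <= M) -> v' t 0 i < v t 0 i ->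
            w t 0 i - w' t 0 i <= C * M}]) ->
  (forall i, v 0 0 i <= v' 0 0 i) ->
  forall t, 0 <= t -> forall i, v t 0 i <= v' t 0 i.
Proof.
move=> vbox v'box vac v'ac vde v'de rate v0 t t0 i.
have -> : (v t 0 i <= v' t 0 i) = ((v - v') t 0 i <= 0) by rewrite !mxE subr_le0.
move: t t0 i; apply: nonpos_invariant.
- move=> T T0 eps eps0; have e2 : 0 < eps / 2 by rewrite divr_gt0.
  have [d d0 hd] := vac T T0 _ e2; have [d' d'0 hd'] := v'ac T T0 _ e2.
  exists (Num.min d d'); first by rewrite lt_min d0.
  move=> N s t st dst; rewrite lt_min => /andP[sd sd'].
  have h := hd N s t st dst sd; have h' := hd' N s t st dst sd'.
  apply: (@le_lt_trans _ _ (\sum_(i < N) (`|v (t i) - v (s i)| + `|v' (t i) - v' (s i)|))).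
    apply: ler_sum => i _.
    have -> : (v - v') (t i) - (v - v') (s i) = (v (t i) - v (s i)) - (v' (t i) - v' (s i)).
      by rewrite !fctE !opprD addrACA.
    exact: ler_normB.
  by rewrite big_split /= (splitr eps); exact: ltrD.
- apply: (ae_lebesgue_imply2 vde v'de) => t dv dv' t0.
  have [dvt _] := dv t0; have [dv't _] := dv' t0; exact: (derivableB dvt dv't).
- move=> s s0 vs; have [|C [r [C0 r0 hC]]] := rate s s0.
    by move=> i; have := vs i; rewrite !mxE subr_le0.
  exists C, r; split=> //.
  apply: (ae_lebesgue_imply2 hC (ae_lebesgue_imply2 vde v'de (fun t => @conj _ _))).
  move=> t wC [dv dv'] t0 ts M i vM; rewrite !mxE subr_gt0 => vi.
  have [dvt Dv] := dv t0; have [dv't Dv'] := dv' t0.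
  rewrite (deriveB dvt dv't) Dv Dv' !mxE.
  have tb := vbox t (ltW t0); have tb' := v'box t (ltW t0).
  have lov : lo 0 i < v t 0 i by apply: le_lt_trans vi; have /andP[] := tb' i.
  have hiv : v' t 0 i < hi 0 i by apply: lt_le_trans vi _; have /andP[] := tb i.
  have p1 := tangent_proj_box_le tb (w t) lov.
  have p2 := tangent_proj_box_ge tb' (w' t) hiv.
  apply: le_trans (wC t0 ts M i _ vi); first exact: lerB.
  by move=> j; have := vM j; rewrite !mxE.
- by move=> i; rewrite !mxE subr_le0.
Qed.

(** * Calculus on row vectors *)

(** Difference quotients in time along a line are difference quotients in the
    direction of the line. *)
Lemma is_derive_line (R : realType) (V W : normedModType R) (h : V -> W)
    (v w : V) (s : R) :
  derivable h (v + s *: w) w ->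
  is_derive (s : R^o) 1 (fun r : R => h (v + r *: w)) ('D_w h (v + s *: w)).
Proof.
have E : (fun k : R => k^-1 *: (((fun r : R => h (v + r *: w)) \o shift s) (k *: (1 : R^o))
    - h (v + s *: w))) =
   (fun k : R => k^-1 *: ((h \o shift (v + s *: w)) (k *: w) - h (v + s *: w))).
  apply/funext => k; congr (_ *: (_ - _)); rewrite /= [k *: 1]mulr1 /shift /=.
  by congr h; rewrite scalerDl addrCA.
move=> dh; apply: DeriveDef; first by rewrite /derivable E.
by rewrite /derive E.
Qed.

Lemma is_derive_line_coord (R : realType) (a b : nat) (h : 'rV[R]_a -> 'rV[R]_b)
    (v w : 'rV[R]_a) (s : R) k :
  differentiable h (v + s *: w) ->
  is_derive (s : R^o) 1 (fun r : R => h (v + r *: w) 0 k)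
    ((w *m jacobian h (v + s *: w)) 0 k).
Proof.
move=> dh; have dhw := diff_derivable (v := w) dh.
have [d1 d2] := is_derive_line dhw.
rewrite -deriveEjacobian // -d2.
exact: is_derive_coord.
Qed.

(** Constants and a ball in place of filters. *)
Lemma locally_lipschitzP (R : realType) (V W : normedModType R) (h : V -> W) (x : V) :
  locally_lipschitz h ->
  exists L r, [/\ 0 < L, 0 < r & forall y z, `|y - x| < r -> `|z - x| < r ->
    `|h y - h z| <= L * `|y - z|].
Proof.
move=> /(_ x)[A /nbhs_normP[r /= r0 rA]] /pinfty_ex_gt0[L L0 hL].
exists L, r; split=> // y z yx zx.
by apply: (hL (y, z)); split; apply: rA; rewrite /= distrC.
Qed.

Lemma locally_lipschitz_continuous (R : realType) (V W : normedModType R) (h : V -> W) :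
  locally_lipschitz h -> continuous h.
Proof.
move=> hl x; have [L [r [L0 r0 hL]]] := locally_lipschitzP x hl.
apply/cvgrPdist_lt => e e0.
have e1 : 0 < Num.min r (e / L) by rewrite lt_min r0 divr_gt0.
near=> y.
have yx : `|y - x| < Num.min r (e / L).
  by rewrite distrC; near: y; apply: cvgr_dist_lt => //; exact: cvg_id.
move: yx; rewrite lt_min => /andP[yr ye].
rewrite distrC; apply: (le_lt_trans (hL y x yr _)); first by rewrite subrr normr0.
by rewrite mulrC -ltr_pdivlMr.
Unshelve. all: by end_near. Qed.

Lemma mulmx_norm_le (R : realType) (a b : nat) (A : 'M[R]_(a, b)) (x : 'rV[R]_a) :
  `|x *m A| <= (\sum_i \sum_j `|A i j|) * `|x|.
Proof.
have s0 i : 0 <= \sum_j `|A i j| by apply: sumr_ge0.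
apply: rV_norm_le => [|k]; first by rewrite mulr_ge0 // sumr_ge0.
rewrite mxE mulr_suml; apply: (le_trans (ler_norm_sum _ _ _)); apply: ler_sum => i _.
rewrite normrM mulrC ler_pM ?ler_norm_coord //.
by rewrite (bigD1 k) //= lerDl sumr_ge0.
Qed.

Lemma continuous_mulmxr (R : realType) (a b : nat) (A : 'M[R]_(a, b)) :
  continuous (fun x : 'rV[R]_a => x *m A).
Proof.
move=> x; pose K := \sum_i \sum_j `|A i j|.
have K0 : 0 <= K by apply: sumr_ge0 => i _; apply: sumr_ge0.
apply/(@cvgrPdist_lt _ _ _ (nbhs x)) => e e0; near=> y.
rewrite -mulmxBl; apply: le_lt_trans (mulmx_norm_le _ _) _.
have xy : `|x - y| < e / (K + 1).
  by near: y; apply: cvgr_dist_lt; [exact: cvg_id | rewrite divr_gt0 // ltr_wpDl].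
apply: (@le_lt_trans _ _ ((K + 1) * `|x - y|)).
  by rewrite ler_wpM2r // lerDl.
by rewrite mulrC -ltr_pdivlMr // ltr_wpDl.
Unshelve. all: by end_near. Qed.

Lemma differentiable_mulmx (R : realType) (a b : nat) (A : 'M[R]_(a, b)) x :
  differentiable (fun x : 'rV[R]_a => x *m A) x.
Proof.
have := @linear_differentiable R 'rV[R]_a 'rV[R]_b (mulmxr A) x.
by apply; exact: continuous_mulmxr.
Qed.

Lemma continuous_bounded_on_ball (R : realType) (n : nat) (h : 'rV[R]_n -> R) (B : R) :
  continuous (h : _ -> R^o) -> exists2 C, 0 <= C & forall x, `|x| <= B -> `|h x| <= C.
Proof.
move=> hc.
have cB : compact [set x : 'rV[R]_n | `|x| <= B].
  apply: bounded_closed_compact.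
    by exists B; split; [exact: num_real | move=> M BM x /= /le_trans; apply; exact: ltW].
  apply: (@closed_comp _ _ (fun x : 'rV[R]_n => `|x|) [set r : R | r <= B]).
    by move=> x _; exact: norm_continuous.
  exact: closed_le.
have /compact_bounded/pinfty_ex_gt0[C C0 hC] : compact ((h : _ -> R^o) @` [set x | `|x| <= B]).
  by apply: continuous_compact => //; apply: continuous_subspaceT.
by exists C; [exact: ltW | move=> x xB; apply: hC; exists x].
Qed.

(** * Gradients of a separable cost *)

(** The chain rule for a map u |-> u A sending basis vectors to basis vectors,
    with which partial gradients are read off from the gradient of the whole cost. *)
Lemma grad_comp_mulmx (R : realType) (a b : nat) (Phi : 'rV[R]_b -> R)
    (psi : 'rV[R]_a -> R) (A : 'M[R]_(a, b)) (c : R) :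
  (forall w, differentiable (Phi : _ -> R^o) w) ->
  (forall u, psi u = Phi (u *m A) - c) ->
  forall u : 'rV[R]_a, differentiable (psi : _ -> R^o) u /\
    forall j k, delta_mx 0 j *m A = delta_mx 0 k :> 'rV[R]_b ->
      grad psi u 0 j = grad Phi (u *m A) 0 k.
Proof.
move=> dPhi psiE u.
have dpsi : differentiable (psi : _ -> R^o) u.
  have -> : (psi : _ -> R^o) = ((Phi : _ -> R^o) \o (fun u => u *m A)) - cst c.
    by apply/funext => v; rewrite psiE.
  apply: differentiableB; last exact: differentiable_cst.
  apply: differentiable_comp; first exact: differentiable_mulmx.
  exact: dPhi.
split=> // j k jk; rewrite !mxE -!deriveE //.
have E : (fun r : R => r^-1 *: (((psi : _ -> R^o) \o shift u) (r *: delta_mx 0 j) - psi u)) =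
  (fun r : R => r^-1 *: (((Phi : _ -> R^o) \o shift (u *m A)) (r *: delta_mx 0 k) - Phi (u *m A))).
  apply/funext => r; rewrite /= !psiE /shift /= mulmxDl -scalemxAl jk.
  by congr (_ *: _); rewrite opprD addrACA subrr addr0.
by rewrite /derive E.
Qed.

Lemma delta_row_mxl (R : realType) (m p : nat) (j : 'I_m) :
  delta_mx 0 j *m row_mx 1%:M 0 = delta_mx 0 (lshift p j) :> 'rV[R]_(m + p).
Proof.
rewrite mul_mx_row mulmx1 mulmx0; apply/rowP => i; rewrite !mxE.
case: fintype.splitP => k ik; rewrite !mxE ?eqxx /=.
  by congr (_%:R); congr (nat_of_bool _); rewrite -!val_eqE /= ik.
by case: eqP => // /(congr1 val) /= e; move: (ltn_ord j); rewrite -e ik ltnNge leq_addr.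
Qed.

Lemma delta_row_mxr (R : realType) (m p : nat) (j : 'I_p) :
  delta_mx 0 j *m row_mx 0 1%:M = delta_mx 0 (rshift m j) :> 'rV[R]_(m + p).
Proof.
rewrite mul_mx_row mulmx1 mulmx0; apply/rowP => i; rewrite !mxE.
case: fintype.splitP => k ik; rewrite !mxE ?eqxx /=.
  by case: eqP => // /(congr1 val) /= e; move: (ltn_ord k); rewrite -ik e ltnNge leq_addr.
by congr (_%:R); congr (nat_of_bool _); rewrite -!val_eqE /= ik eqn_add2l.
Qed.

(** Each summand of a separable cost is, up to a constant, the cost with the other
    argument set to 0, and inherits its regularity. *)
Lemma cost_grad_split (R : realType) (m p : nat) (Phi : 'rV[R]_(m + p) -> R)
    (Phiu : 'rV[R]_m -> R) (Phiy : 'rV[R]_p -> R) (umin umax : 'rV[R]_m) :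
  cost_assumption Phi Phiu Phiy umin umax ->
  [/\ forall u i, grad Phiu u 0 i = grad Phi (u *m row_mx 1%:M 0) 0 (lshift p i),
      forall y k, grad Phiy y 0 k = grad Phi (y *m row_mx 0 1%:M) 0 (rshift m k) &
      forall y, differentiable (Phiy : _ -> R^o) y].
Proof.
move=> [sep dPhi _ _ _].
have uE u : Phiu u = Phi (u *m row_mx 1%:M 0) - Phiy 0.
  by rewrite mul_mx_row mulmx1 mulmx0 sep addrK.
have yE y : Phiy y = Phi (y *m row_mx 0 1%:M) - Phiu 0.
  by rewrite mul_mx_row mulmx1 mulmx0 sep addrC addKr.
split.
- by move=> u i; have [_] := grad_comp_mulmx dPhi uE u; apply; exact: delta_row_mxl.
- by move=> y k; have [_] := grad_comp_mulmx dPhi yE y; apply; exact: delta_row_mxr.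
- by move=> y; have [] := grad_comp_mulmx dPhi yE y.
Qed.

Lemma cost_gradient_lipschitz (R : realType) (m p : nat) (Phi : 'rV[R]_(m + p) -> R)
    (Phiu : 'rV[R]_m -> R) (Phiy : 'rV[R]_p -> R) (umin umax : 'rV[R]_m) (z : 'rV[R]_m) :
  cost_assumption Phi Phiu Phiy umin umax ->
  exists L r, [/\ 0 < L, 0 < r & forall v v', `|v - z| < r -> `|v' - z| < r ->
    `|grad Phiu v - grad Phiu v'| <= L * `|v - v'|].
Proof.
move=> hc; have [uE _ _] := cost_grad_split hc.
pose A : 'M[R]_(m, m + p) := row_mx 1%:M 0.
have [L [r [L0 r0 hL]]] := locally_lipschitzP (z *m A) (cost_lip hc).
pose K := \sum_i \sum_j `|A i j| + 1.
have K0 : 0 < K by rewrite ltr_wpDl // sumr_ge0 // => i _; rewrite sumr_ge0.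
have AK (x y : 'rV[R]_m) : `|x *m A - y *m A| <= K * `|x - y|.
  rewrite -mulmxBl; apply: le_trans (mulmx_norm_le _ _) _.
  by rewrite ler_wpM2r // lerDl.
exists (L * K), (r / K); split; rewrite ?divr_gt0 ?mulr_gt0 // => v v' vz v'z.
have near_z x : `|x - z| < r / K -> `|x *m A - z *m A| < r.
  by rewrite ltr_pdivlMr // mulrC => xz; apply: le_lt_trans xz.
apply: rV_norm_le => [|i]; first by rewrite !mulr_ge0 // ltW.
have := hL _ _ (near_z _ vz) (near_z _ v'z).
move=> /(le_trans (ler_norm_coord _ (lshift p i))); rewrite rV_coordB => h.
rewrite rV_coordB.
have -> := congr2 (fun a b => a - b) (uE v i) (uE v' i).
apply: le_trans h _; rewrite -mulrA; apply: ler_wpM2l; first exact: ltW.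
exact: AK.
Qed.

Lemma output_gradient_continuous (R : realType) (m p n : nat)
    (Phi : 'rV[R]_(m + p) -> R)
    (Phiu : 'rV[R]_m -> R) (Phiy : 'rV[R]_p -> R) (umin umax : 'rV[R]_m)
    (g : 'rV[R]_n -> 'rV[R]_p) k :
  cost_assumption Phi Phiu Phiy umin umax -> locally_lipschitz g ->
  continuous ((fun x => grad Phiy (g x) 0 k) : 'rV[R]_n -> R^o).
Proof.
move=> hc gl; have [_ yE _] := cost_grad_split hc.
have -> : (fun x => grad Phiy (g x) 0 k) =
    (fun z => z 0 (rshift m k)) \o grad Phi \o (fun y => y *m row_mx 0 1%:M) \o g.
  by apply/funext => x; rewrite /= -yE.
move=> x; apply: continuous_comp; first exact: locally_lipschitz_continuous.
apply: continuous_comp; first exact: continuous_mulmxr.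
apply: (@continuous_comp _ _ _ (grad Phi) (fun z => z 0 (rshift m k))).
  exact: (cost_C1 hc).
exact: coord_continuous.
Qed.

(** * Order properties of gradients *)

(** Mean value theorem on the segment from v to v + w. *)
Lemma nonincreasing_along (R : realType) (a b : nat) (h : 'rV[R]_a -> 'rV[R]_b)
    (v w : 'rV[R]_a) k :
  (forall z, differentiable h z) ->
  (forall z, (w *m jacobian h z) 0 k <= 0) -> h (v + w) 0 k <= h v 0 k.
Proof.
move=> dh hw.
pose phi (r : R) : R := h (v + r *: w) 0 k.
have dphi (x : R) : is_derive (x : R^o) 1 phi ((w *m jacobian h (v + x *: w)) 0 k).
  exact: is_derive_line_coord.
have cphi : {within `[0, 1], continuous phi}.
  by apply: derivable_within_continuous => x _; have [] := dphi x.
have [c _] := MVT ltr01 (fun x _ => dphi x) cphi.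
rewrite /phi scale1r scale0r addr0 subr0 mulr1 => e.
by rewrite -subr_le0 e.
Qed.

Lemma nonneg_grad_monotone (R : realType) (p : nat) (F : 'rV[R]_p -> R) :
  twice_differentiable F -> (forall y i j, 0 <= hessian F y i j) ->
  forall y y' : 'rV[R]_p, (forall k, y' 0 k <= y 0 k) ->
  forall k, grad F y' 0 k <= grad F y 0 k.
Proof.
move=> [_ d2] H0 y y' yy k.
have -> : y' = y + (y' - y) by rewrite addrC subrK.
apply: nonincreasing_along => // z; rewrite mxE; apply: sumr_le0 => j _.
rewrite mulr_le0_ge0 //; first by rewrite !mxE subr_le0.
by have := H0 z k j; rewrite /hessian /jac mxE.
Qed.

(** Along a nonnegative direction d with d_i = 0 only off-diagonal entries of the
    i-th row of the Hessian enter. *)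
Lemma nonpos_offdiag_grad (R : realType) (m : nat) (F : 'rV[R]_m -> R) :
  twice_differentiable F ->
  (forall v i j, i != j -> hessian F v i j <= 0) ->
  forall (z d : 'rV[R]_m) i, (forall j, 0 <= d 0 j) -> d 0 i = 0 ->
  grad F (z + d) 0 i <= grad F z 0 i.
Proof.
move=> [_ d2] H0 z d i d0 di.
apply: nonincreasing_along => // x; rewrite mxE; apply: sumr_le0 => j _.
have [->|ji] := eqVneq j i; first by rewrite di mul0r.
rewrite mulr_ge0_le0 //.
by have := H0 x i j; rewrite eq_sym ji /hessian /jac mxE => /(_ isT).
Qed.

(** A gap would contradict the convexity inequality at a small enough step s from
    x towards y. *)
Lemma convex_tangent_le (R : realType) (V : normedModType R) (f : V -> R) (x y : V) :
  convex_function (setT : set V) f -> differentiable (f : V -> R^o) x ->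
  'd (f : V -> R^o) x (y - x) <= f y - f x.
Proof.
move=> cf df; rewrite leNgt; apply/negP => gap.
have dl : derivable (f : V -> R^o) (x + 0 *: (y - x)) (y - x).
  by rewrite scale0r addr0; exact: diff_derivable.
have := is_derive_line dl; rewrite scale0r addr0 deriveE // => dphi.
pose d : R := 'd (f : V -> R^o) x (y - x).
have e0 : 0 < (d - (f y - f x)) / 2 by rewrite divr_gt0 // subr_gt0.
have [r r0 hr] := is_derive_increment dphi e0.
pose s := Num.min (r / 2) 1.
have s0 : 0 < s by rewrite lt_min divr_gt0 // ltr01.
have s1 : s <= 1 by rewrite ge_min lexx orbT.
have sr : s < r by rewrite gt_min; apply/orP; left; lra.
have cs : f (x + s *: (y - x)) <= s * f y + (1 - s) * f x.
  have := cf (Itv01 (ltW s0) s1) y x; rewrite !inE => /(_ Logic.I Logic.I).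
  rewrite (_ : x + s *: (y - x) = s *: y + (1 - s) *: x) //.
  by rewrite scalerBr scalerBl scale1r addrC -addrA [- _ + _]addrC.
have := hr s; rewrite subr0 gtr0_norm // => /(_ sr) /ler_normlP[+ _].
rewrite scale0r addr0 -/d => h.
have : s * (f y - f x) < s * d by rewrite ltr_pM2l.
lra.
Qed.

(** The tangent inequalities at y and at y' add up to the monotonicity of the
    derivative. *)
Lemma convex_grad_monotone (R : realType) (F : 'rV[R]_1 -> R) :
  convex_function (setT : set 'rV[R]_1) F ->
  (forall y, differentiable (F : _ -> R^o) y) ->
  forall y y' : 'rV[R]_1, y' 0 0 <= y 0 0 -> grad F y' 0 0 <= grad F y 0 0.
Proof.
move=> cF dF y y' yy.
have aux (s s' G G' c c' : R) : (s' - s) * G <= c' - c -> (s - s') * G' <= c - c' ->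
    0 < s - s' -> G' <= G.
  by move=> h1 h2 s0; rewrite -(ler_pM2l s0); lra.
have E z w : 'd (F : _ -> R^o) z w = w 0 0 * grad F z 0 0.
  have -> : w = w 0 0 *: delta_mx 0 0.
    by apply/rowP => i; rewrite !mxE !ord1 mulr1.
  by rewrite linearZ !mxE mulr1.
have h1 : 'd (F : _ -> R^o) y (y' - y) <= F y' - F y by exact: convex_tangent_le.
have h2 : 'd (F : _ -> R^o) y' (y - y') <= F y - F y' by exact: convex_tangent_le.
rewrite E rV_coordB in h1; rewrite E rV_coordB in h2.
have [e|e] := eqVneq (y' 0 0) (y 0 0).
  by have -> : y' = y by apply/rowP => i; rewrite ord1.
have e' : 0 < y 0 0 - y' 0 0 by rewrite subr_gt0 lt_neqAle e.
exact: aux h1 h2 e'.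
Qed.

(** * The steady-state output map and the inputs *)

(** A negative entry would make the map decrease along a small step in the
    corresponding basis direction. *)
Lemma jac_ge0_of_monotone (R : realType) (a b : nat) (h : 'rV[R]_a -> 'rV[R]_b) :
  (forall z, differentiable h z) ->
  (forall x y : 'rV[R]_a, (forall i, x 0 i <= y 0 i) -> forall k, h x 0 k <= h y 0 k) ->
  forall v k j, 0 <= jac h v k j.
Proof.
move=> dh hmono v k j; rewrite leNgt; apply/negP => neg.
have aux (p q l u : R) : l < 0 -> 0 < u -> q <= p ->
    p - q - l * u <= - l / 2 * u -> False.
  by move=> l0 u0; have : l * u < 0 by [rewrite pmulr_llt0]; lra.
have [|dphi dE] := @is_derive_line_coord R a b h v (delta_mx 0 j) 0 k; first exact: dh.
have {}dphi : is_derive (0 : R^o) 1 (fun r : R => h (v + r *: delta_mx 0 j) 0 k)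
    (jac h v k j).
  by apply: DeriveDef => //; rewrite dE scale0r addr0 /jac -rowE !mxE.
have e0 : 0 < - jac h v k j / 2 by rewrite divr_gt0 // oppr_gt0.
have [r r0 hr] := is_derive_increment dphi e0.
have r20 : 0 < r / 2 by rewrite divr_gt0.
have := hr (r / 2); rewrite subr0 gtr0_norm // => /(_ ltac:(lra)) /ler_normlP[_].
have : h (v + 0 *: delta_mx 0 j) 0 k <= h (v + (r / 2) *: delta_mx 0 j) 0 k.
  apply: hmono => i; rewrite !mxE mul0r addr0 lerDl mulr_ge0 //; exact: ltW.
by move=> h1 h2; exact: aux neg r20 h1 h2.
Qed.

(** The difference quotients of an affine map do not depend on the base point. *)
Lemma jac_affine (R : realType) (a b : nat) (h : 'rV[R]_a -> 'rV[R]_b)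
    (A : 'M[R]_(a, b)) (s : 'rV[R]_b) :
  (forall v, differentiable h v) -> (forall v, h v = v *m A + s) ->
  forall v v', jac h v = jac h v'.
Proof.
move=> dh hE v v'; rewrite /jac.
have -> // : jacobian h v = jacobian h v'.
apply/row_matrixP => i.
have rowD z : row i ('J h z) = 'D_(delta_mx 0 i) h z.
  by rewrite (deriveEjacobian _ (dh z)) -rowE.
apply: (etrans (rowD v)); apply: (etrans _ (esym (rowD v'))).
have E z : (fun k : R => k^-1 *: ((h \o shift z) (k *: delta_mx 0 i) - h z)) =
    (fun k : R => k^-1 *: ((k *: delta_mx 0 i) *m A)).
  apply/funext => k; rewrite /= !hE mulmxDl.
  by rewrite opprD addrACA subrr addr0 addrK.
have E2 := etrans (E v) (esym (E v')).
by rewrite /derive E2.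
Qed.

Lemma admissible_cst (R : realType) (m : nat) (u : 'rV[R]_m) :
  admissible_input (cst u : R -> _).
Proof.
split=> [i|]; first exact: measurable_cst.
move=> t _; exists `|u|; split; first exact: num_real.
by move=> M /ltW uM; apply: nearW.
Qed.

(** Two solutions from the same initial state with ordered constant inputs stay
    ordered, hence so do their limits, the steady states. *)
Lemma steady_output_monotone (R : realType) (n m p : nat)
    (f : 'rV[R]_n * 'rV[R]_m -> 'rV[R]_n) (g : 'rV[R]_n -> 'rV[R]_p)
    (kx : 'rV[R]_m -> 'rV[R]_n) (ky : 'rV[R]_m -> 'rV[R]_p) :
  plant_assumption f g kx ky ->
  monotone_system nonneg_orthant nonneg_orthant nonneg_orthant setT f g ->
  forall u u' : 'rV[R]_m, (forall i, u 0 i <= u' 0 i) ->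
  forall k, ky u 0 k <= ky u' 0 k.
Proof.
move=> hp [mono gmono] u u' uu' k.
have [[x sx x0] limx] := plant_steady hp u 0.
have [[x' sx' x0'] limx'] := plant_steady hp u' 0.
have {}limx := limx x sx x0; have {}limx' := limx' x' sx' x0'.
have xx' t : 0 <= t -> forall i, x t 0 i <= x' t 0 i.
  move=> t0; apply/order_of_nonneg.
  apply: (mono (cst u') (cst u) x' x) => //; try exact: admissible_cst.
  - by apply: aeW => s _; apply/order_of_nonneg.
  - by rewrite x0 x0'; apply/order_of_nonneg.
rewrite (plant_ky_def hp) /=; apply/order_of_nonneg : k; apply: gmono => //.
apply/order_of_nonneg => i.
have lim_coord (z : R -> 'rV[R]_n) (l : 'rV[R]_n) :
    z t @[t --> +oo] --> l -> z t 0 i @[t --> +oo] --> l 0 i.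
  by move=> zl; apply: (cvg_comp _ (fun v : 'rV[R]_n => v 0 i) zl); exact: coord_continuous.
apply: (ler_cvg_to (lim_coord _ _ limx) (lim_coord _ _ limx')).
by near=> t; apply: xx'; near: t; exact: nbhs_pinfty_ge.
Unshelve. all: by end_near. Qed.

Lemma admissible_input_bounded (R : realType) (n : nat) (u : R -> 'rV[R]_n) (s : R) :
  admissible_input u -> 0 <= s ->
  exists B r, 0 < r /\ forall t, 0 <= t -> `|t - s| < r -> `|u t| <= B.
Proof.
move=> [_ ub] s0.
have /pinfty_ex_gt0[B _] : bounded_near u (within `[0, +oo[ (nbhs s)).
  by apply: (ub s); rewrite /= in_itv /= s0.
move=> /nbhs_normP[r /= r0 hr]; exists B, r; split=> // t t0 ts.
by apply: hr; rewrite /= ?in_itv /= ?t0 // distrC.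
Qed.

(** * Quasimonotonicity of the gradient field *)

Definition rV_max (R : realType) (m : nat) (v v' : 'rV[R]_m) : 'rV[R]_m :=
  \row_j Num.max (v 0 j) (v' 0 j).

(** If z <= z' then z' is the maximum of z and z', and taking maxima is
    nonexpansive. This brings the intermediate point of [gradient_field_gap] into
    the region where the local Lipschitz constant is valid. *)
Lemma rV_max_near (R : realType) (m : nat) (v v' z z' : 'rV[R]_m) (r : R) :
  (forall j, z 0 j <= z' 0 j) -> `|v - z| < r -> `|v' - z'| < r ->
  `|rV_max v v' - z'| < r.
Proof.
move=> zz vz vz'.
apply: (@le_lt_trans _ _ (Num.max `|v - z| `|v' - z'|)); last by rewrite gt_max vz.
apply: rV_norm_le => [|j]; first by rewrite le_max normr_ge0.
have h1 : `|v 0 j - z 0 j| <= Num.max `|v - z| `|v' - z'|.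
  by have := ler_norm_coord (v - z) j; rewrite !mxE le_max => ->.
have h2 : `|v' 0 j - z' 0 j| <= Num.max `|v - z| `|v' - z'|.
  by have := ler_norm_coord (v' - z') j; rewrite !mxE le_max => ->; rewrite orbT.
have := zz j; move: h1 h2; rewrite !mxE; move: (Num.max `|_| _) => B.
by case: (leP (v 0 j) (v' 0 j)) => ? /ler_normlP[? ?] /ler_normlP[? ?] ?;
  apply/ler_normlP; split; lra.
Qed.

(** The four steps of the introductory comment, at a fixed time: a, b, K stand for
    grad Phiu, grad Phiy and the Jacobian of the steady-state output map; N bounds
    the contribution of the variation of K. *)
Lemma gradient_field_gap (R : realType) (m p : nat) (a : 'rV[R]_m -> 'rV[R]_m)
    (b : 'rV[R]_p -> 'rV[R]_p) (K : 'rV[R]_m -> 'M[R]_(p, m))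
    (v v' : 'rV[R]_m) (y y' : 'rV[R]_p) (i : 'I_m) (L M N : R) :
  (forall z d : 'rV[R]_m, (forall j, 0 <= d 0 j) -> d 0 i = 0 ->
     a (z + d) 0 i <= a z 0 i) ->
  (forall k, b y' 0 k <= b y 0 k) -> (forall k, 0 <= K v' k i) ->
  0 <= L -> (forall j, v 0 j - v' 0 j <= M) -> v' 0 i < v 0 i ->
  `|a v' - a (rV_max v v')| <= L * `|v' - rV_max v v'| ->
  \sum_k b y 0 k * (K v' k i - K v k i) <= N ->
  (a v' + b y' *m K v') 0 i - (a v + b y *m K v) 0 i <= L * M + N.
Proof.
move=> offdiag bmono K0 L0 vM vi aL bN.
have M0 : 0 <= M by have := vM i; lra.
have h1 : a v' 0 i - a (rV_max v v') 0 i <= L * M.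
  apply: le_trans (ler_norm _) _.
  have := ler_norm_coord (a v' - a (rV_max v v')) i; rewrite !mxE => /le_trans; apply.
  apply: le_trans aL _; apply: ler_wpM2l => //; apply: rV_norm_le => // j.
  rewrite !mxE distrC; case: (leP (v 0 j) (v' 0 j)) => vj; first by rewrite subrr normr0.
  by rewrite ger0_norm ?vM // subr_ge0 ltW.
have h2 : a (rV_max v v') 0 i <= a v 0 i.
  have -> : rV_max v v' = v + (rV_max v v' - v) by rewrite addrC subrK.
  apply: offdiag => [j|]; rewrite !mxE; first by rewrite subr_ge0 le_max lexx.
  by rewrite max_l ?subrr // ltW.
have h3 : (b y' *m K v') 0 i - (b y *m K v) 0 i <= N.
  apply: le_trans bN; rewrite !mxE -sumrB; apply: ler_sum => k _.
  have := ler_wpM2r (K0 k) (bmono k); rewrite mulrBr; lra.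
rewrite !mxE in h3 *; lra.
Qed.

(** In dimension one v is the maximum of v and v' as soon as v' < v, so it is close
    to v' s and the local Lipschitz bound on K applies; the factor q is locally bounded
    because the input is. *)
Lemma jacobian_gap_bound1 (R : realType) (n : nat) (q : 'rV[R]_n -> 'rV[R]_1)
    (K : 'rV[R]_1 -> 'M[R]_(1, 1)) (u : R -> 'rV[R]_n) (v v' : R -> 'rV[R]_1) (s : R) :
  continuous ((fun x => q x 0 0) : 'rV[R]_n -> R^o) ->
  locally_lipschitz K -> admissible_input u ->
  (forall T, 0 <= T -> absolutely_continuous_on 0 T v) ->
  (forall T, 0 <= T -> absolutely_continuous_on 0 T v') ->
  0 <= s -> (forall i, v s 0 i <= v' s 0 i) ->
  exists N r, [/\ 0 <= N, 0 < r & forall t, 0 <= t -> `|t - s| < r ->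
    forall M i, (forall j, v t 0 j - v' t 0 j <= M) -> v' t 0 i < v t 0 i ->
      \sum_k q (u t) 0 k * (K (v' t) k i - K (v t) k i) <= N * M].
Proof.
move=> qc Kl uadm vac v'ac s0 vs.
have [B [r1 [r10 uB]]] := admissible_input_bounded uadm s0.
have [C C0 qC] := continuous_bounded_on_ball B qc.
have [L [r2 [L0 r20 KL]]] := locally_lipschitzP (v' s) Kl.
have [r3 r30 vn] := absolutely_continuous_near vac s0 r20.
have [r4 r40 v'n] := absolutely_continuous_near v'ac s0 r20.
exists (C * L), (Num.min r1 (Num.min r3 r4)).
split; [by rewrite mulr_ge0 // ltW | by rewrite !lt_min r10 r30 |].
move=> t t0; rewrite !lt_min => /and3P[tr1 tr3 tr4] M i vM vi.
rewrite big_ord1 !ord1.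
have i0 : i = 0 by rewrite ord1.
rewrite i0 in vi *.
have vv : rV_max (v t) (v' t) = v t.
  by apply/rowP => j; rewrite mxE ord1 max_l // ltW.
have vnear : `|v t - v' s| < r2.
  by rewrite -vv; apply: rV_max_near vs _ _; [exact: vn | exact: v'n].
have Kgap : `|K (v' t) 0 0 - K (v t) 0 0| <= L * M.
  rewrite -rV_coordB; apply: le_trans (ler_norm_coord _ _) _.
  apply: le_trans (KL _ _ (v'n t t0 tr4) vnear) _.
  apply: ler_wpM2l; first exact: ltW.
  apply: rV_norm_le => [|j]; first by have := vM 0; lra.
  by rewrite rV_coordB ord1 distrC gtr0_norm ?subr_gt0.
apply: le_trans (ler_norm _) _; rewrite normrM -mulrA.
by apply: ler_pM => //; apply: qC; exact: uB.
Qed.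

Lemma scaled_field_coordB (R : realType) (m : nat) (alpha : R)
    (a b a' b' : 'rV[R]_m) i :
  (- (alpha *: a) - alpha *: b) 0 i - (- (alpha *: a') - alpha *: b') 0 i =
  alpha * ((a' + b') 0 i - (a + b) 0 i).
Proof. by rewrite !mxE; ring. Qed.

Unset Implicit Arguments.

Theorem lemma2 (R : realType) (n m p : nat)
    (f : 'rV[R]_n * 'rV[R]_m -> 'rV[R]_n) (g : 'rV[R]_n -> 'rV[R]_p)
    (kx : 'rV[R]_m -> 'rV[R]_n) (ky : 'rV[R]_m -> 'rV[R]_p)
    (Phi : 'rV[R]_(m + p) -> R)
    (Phiu : 'rV[R]_m -> R) (Phiy : 'rV[R]_p -> R)
    (umin umax : 'rV[R]_m) (alpha : R)
    (hplant : plant_assumption f g kx ky)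
    (hcost : cost_assumption Phi Phiu Phiy umin umax)
    (hmono : monotone_system nonneg_orthant nonneg_orthant nonneg_orthant
               setT f g)
    (halpha : 0 < alpha)
    (hcases :
       [/\ m = 1%N, p = 1%N & convex_function (setT : set 'rV[R]_p) Phiy]
       \/
       [/\ exists (S : 'M[R]_(p, m)) (s : 'rV[R]_p),
             forall v, ky v = v *m S^T + s,
           twice_differentiable Phiu /\
             (forall v i j, i != j -> hessian Phiu v i j <= 0) &
           twice_differentiable Phiy /\
             (forall y i j, 0 <= hessian Phiy y i j)]) :
  monotone_system nonneg_orthant nonpos_orthant nonpos_orthant
    (box umin umax)
    (fun vx : 'rV[R]_m * 'rV[R]_n =>
       tangent_proj (box umin umax) vx.1
         (- (alpha *: grad Phiu vx.1)
          - alpha *: (grad Phiy (g vx.2) *m jac ky vx.1)))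
    (fun v => v).
Proof.
split=> // x x' v v' xadm x'adm xx' [vbox vac vde] [v'box v'ac v'de] v0 t t0.
apply/order_of_nonpos; move: t t0.
pose w (x : R -> 'rV[R]_n) (v : R -> 'rV[R]_m) t :=
  - (alpha *: grad Phiu (v t)) - alpha *: (grad Phiy (g (x t)) *m jac ky (v t)).
apply: (@projected_flow_comparison R m umin umax (w x v) (w x' v') v v'
  vbox v'box vac v'ac vde v'de); last by move/order_of_nonpos: v0.
move=> s s0 vs.
have jac0 : forall z k i, 0 <= jac ky z k i.
  apply: jac_ge0_of_monotone; first exact: plant_ky_diff hplant.
  exact: steady_output_monotone hplant hmono.
have gmono (z z' : 'rV[R]_n) : order_of nonneg_orthant z z' ->
    forall k, g z' 0 k <= g z 0 k.
  by move=> zz; apply/order_of_nonneg; exact: hmono.2.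
have [L [r1 [L0 r10 hL]]] := cost_gradient_lipschitz (v' s) hcost.
have [r2 r20 vn] := absolutely_continuous_near vac s0 r10.
have [r3 r30 v'n] := absolutely_continuous_near v'ac s0 r10.
have [_ _ dPhiy] := cost_grad_split hcost.
have [N [r4 [N0 r40 hN]]] : exists N r, [/\ 0 <= N, 0 < r &
  forall t, 0 <= t -> `|t - s| < r ->
    forall M i, (forall j, v t 0 j - v' t 0 j <= M) -> v' t 0 i < v t 0 i ->
      \sum_k grad Phiy (g (x t)) 0 k * (jac ky (v' t) k i - jac ky (v t) k i) <= N * M].
  case: hcases => [[m1 p1 _]|[[S [b kyE]] _ _]].
    subst m p.
    apply: (@jacobian_gap_bound1 R n (fun z => grad Phiy (g z))) => //.
      exact: output_gradient_continuous hcost (plant_g_lip hplant).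
    exact: plant_ky_lip hplant.
  exists 0, 1; split=> // t _ _ M i _ _; rewrite mul0r.
  rewrite (jac_affine (plant_ky_diff hplant) kyE (v' t) (v t)).
  by rewrite big1 // => k _; rewrite subrr mulr0.
have bmono (y y' : 'rV[R]_p) : (forall k, y' 0 k <= y 0 k) ->
    forall k, grad Phiy y' 0 k <= grad Phiy y 0 k.
  case: hcases => [[_ p1 cPhiy]|[_ _ [d2 H0]]]; last exact: nonneg_grad_monotone.
  by subst p => yy k; rewrite !ord1; apply: convex_grad_monotone.
have offdiag (z d : 'rV[R]_m) i : (forall j, 0 <= d 0 j) -> d 0 i = 0 ->
    grad Phiu (z + d) 0 i <= grad Phiu z 0 i.
  case: hcases => [[m1 _ _]|[_ [d2 H0] _]]; last exact: nonpos_offdiag_grad.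
  subst m => _ d0; suff -> : d = 0 by rewrite addr0.
  by apply/rowP => j; rewrite mxE -d0 !ord1.
exists (alpha * (L + N)), (Num.min (Num.min r2 r3) r4); split.
- by rewrite mulr_ge0 ?addr_ge0 // ltW.
- by rewrite !lt_min r20 r30.
- apply: negligibleS xx' => t; apply: contra_not => xt t_gt0.
  have t0 := ltW t_gt0; have {}xt := xt t0.
  rewrite !lt_min => /andP[/andP[tr2 tr3] tr4] M i vM vi.
  have gap := @gradient_field_gap R m p (grad Phiu) (grad Phiy) (jac ky) (v t) (v' t)
    (g (x t)) (g (x' t)) i L M (N * M).
  have {}gap := gap (fun z d => offdiag z d i) (bmono _ _ (gmono _ _ xt))
    (fun k => jac0 _ k i) (ltW L0) vM vi.
  have rmax : `|rV_max (v t) (v' t) - v' s| < r1.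
    by apply: rV_max_near vs _ _; [exact: vn | exact: v'n].
  have {}gap := gap (hL _ _ (v'n t t0 tr3) rmax) (hN t t0 tr4 M i vM vi).
  rewrite -mulrDl in gap.
  have -> : w x v t 0 i - w x' v' t 0 i =
    alpha * ((grad Phiu (v' t) + grad Phiy (g (x' t)) *m jac ky (v' t)) 0 i
      - (grad Phiu (v t) + grad Phiy (g (x t)) *m jac ky (v t)) 0 i).
    exact: scaled_field_coordB.
  by rewrite -mulrA; apply: ler_wpM2l; first exact: ltW.
Qed.
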